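(* Let $A$ be a principal ideal domain, $S$ a set and $\tilde w\colon\{1,\dots,n\}\to S\cup S^{-1}$ a word. Every element $T\in Bar^0(\tilde w;A)=T(C^1(\tilde w;A))$ is cohomologous to a polynomial in $\delta_0$ (a linear combination of tensors $(\delta_0|\cdots|\delta_0)$), and the isomorphism $L\colon H^0_{Bar}(\tilde w;A)\to A[t]$ sends a polynomial in $\delta_0$ to one in $t$ by the substitution $\delta_0\mapsto t$. Identify $\delta_0$ with $t$. The polynomial can be computed via the following weight-reduction procedure. Given a tensor $(\alpha_1|\cdots|\alpha_m)$ such that every $\alpha_i$ is either $t$ or of the form $f\,dx$, let its modified weight be $m-\#\{i:\alpha_i=t\}$. (1) If the modified weight is $0$, the tensor is already a polynomial in $t$, and one halts. Otherwise pick one $\alpha_k=f\,dx$. (2) The tensor $(\alpha_1|\cdots|\alpha_{k-1}|f\,dx|\alpha_{k+1}|\cdots|\alpha_m)$ is cohomologous to $$\Big(\int_wf\,dx\Big)(\alpha_1|\cdots|\alpha_{k-1}|t|\alpha_{k+1}|\cdots|\alpha_m)-(\alpha_1|\cdots|\alpha_{k-2}|\alpha_{k-1}\smile d^{-1}(f\,dx)|\alpha_{k+1}|\cdots|\alpha_m)+(\alpha_1|\cdots|\alpha_{k-1}|d^{-1}(f\,dx)\smile\alpha_{k+1}|\alpha_{k+2}|\cdots|\alpha_m),$$ where if $f\,dx$ is one of the extremal entries the term with undefined cup product is omitted. The cup products are given by $$t\smile d^{-1}(f\,dx)=-\Big(\int_wf\,dx\Big)t,\qquad d^{-1}(f\,dx)\smile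 t=0,$$ $$g\,dx\smile d^{-1}(f\,dx)=-\Big(\int_{\partial_1(\bullet)}^{n+1}f\,dx\Big)g\,dx,\qquad d^{-1}(f\,dx)\smile g\,dx=-\Big(\int_{\partial_0(\bullet)}^{n+1}f\,dx\Big)g\,dx,$$ where $\partial_0(i)$ and $\partial_1(i)$ are the initial and terminal vertices of the $i$-th segment and $\int_0^{n+1}f\,dx:=0$. (3) The summands obtained in step (2) have strictly smaller modified weight than the original tensor; one collects like terms and returns to step (1) for each resulting summand.
   Context: $A$ is a PID. Let $[n]=\{1,\dots,n\}$ and $[n]_*=\{0,\dots,n\}$, considered modulo $n+1$. Let $(-1)^{s}=1$, $(-1)^{s^{-1}}=-1$ for $s\in S$, with position $0$ treated as if its letter were in $S$ (positive). The loop $S^1(\tilde w)$ is the simplicial circle with vertices $[n]_*$ (basepoint $0$) and, for each $i\in[n]_*$, an edge (the $i$-th segment) joining $i$ and $i+1$ (mod $n+1$), oriented from $i$ to $i+1$ if $\tilde w(i)\in S$ or $i=0$ (so $\partial_0(i)=i$, $\partial_1(i)=i+1$), and from $i+1$ to $i$ if $\tilde w(i)\in S^{-1}$ (so $\partial_0(i)=i+1$, $\partial_1(i)=i$). Its cochain algebra $C^*(\tilde w;A)$ is: $C^0=C^1=\{a\colon[n]_*\to A\}$, other $C^i=0$; $(df)_i=(-1)^{\tilde w(i)}(f_{i+1}-f_i)$; $(f\smile g)_i=f_ig_i$ for functions; and for $f\in C^0$, $\alpha\in C^1$: $(f\smile\alpha)_i=f_{\partial_0(i)}\alpha_i$ and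 $(\alpha\smile f)_i=f_{\partial_1(i)}\alpha_i$. The augmentation is $f\mapsto f_0$. Bar construction. For an augmented dg algebra $C$ with augmentation ideal $\overline C$, $Bar(C)=\bigoplus_p(\overline C[1])^{\otimes p}$, with $(c_1|\cdots|c_p)$ of degree $\sum(|c_i|-1)$ and $d_{Bar}=d_1+d_2$, $d_1(c_1|\cdots|c_p)=-\sum_i(-1)^{(i-1)+|c_1|+\dots+|c_{i-1}|}(c_1|\cdots|dc_i|\cdots|c_p)$, $d_2(c_1|\cdots|c_p)=-\sum_{i<p}(-1)^{i+|c_1|+\dots+|c_i|}(c_1|\cdots|c_ic_{i+1}|\cdots|c_p)$. $Bar^*(\tilde w;A)=Bar(C^*(\tilde w;A))$ and $H^*_{Bar}(\tilde w;A)$ is its cohomology; cohomologous means differing by a $d_{Bar}$-coboundary. Let $S^1_\bullet$ be the simplicial circle with one vertex and one nondegenerate edge, $\tau$ its $1$-cochain with value $1$ on that edge, so its $0$-th bar cohomology is $A[t]$, $t^p=(\tau|\cdots|\tau)$. The pointed map $S^1(\tilde w)\to S^1_\bullet$ collapsing all edges except the $0$-th one, which is sent to the nondegenerate edge, induces an isomorphism $A[t]\to H^0_{Bar}(\tilde w;A)$; $L$ is its inverse. Forms. $\delta_0\in C^1$ is the indicator of $0$. For $f\colon[n]\to A$, $f\,dx\in C^1$ is $(f\,dx)_i=f_i$ if $\tilde w(i)\in S$, $-f_i$ if $\tilde w(i)\in S^{-1}$, and $0$ if $i=0$. For $1\le i\le j\le n+1$, $\int_i^jf\,dx:=f_i+f_{i+1}+\dots+f_{j-1}$,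 and $\int_wf\,dx:=f_1+\dots+f_n$. The cobounding of $f\,dx$ is $d^{-1}(f\,dx)\in C^0$, $d^{-1}(f\,dx)_j=\int_1^jf\,dx-\int_wf\,dx=-(f_j+\dots+f_n)$ for $1\le j\le n$, and $d^{-1}(f\,dx)_0=0$. Every form in $C^1(\tilde w;A)$ is uniquely $f\,dx-a_0\delta_0$. *)

(* Defs.v *)
From HB Require Import structures.
From mathcomp Require Import all_boot all_order all_algebra.
From mathcomp Require Import zify boolp.
From mathcomp Require Import finmap monalg.
Set Implicit Arguments.
Unset Strict Implicit.
Unset Printing Implicit Defensive.
Import GRing.Theory.
Local Open Scope ring_scope.
Section Modules.
Variables (A : comNzRingType) (V : lmodType A).

Inductive spanned (X : V -> Prop) : V -> Prop :=
| spanned0 : spanned X 0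
| spannedS a x y : X x -> spanned X y -> spanned X (a *: x + y).

Definition submod_span (X : V -> Prop) : {pred V} := fun x => `[< spanned X x >].

Lemma submod_span_closed X : submod_closed (submod_span X).
Proof.
split=> [|a x y]; first by apply/asboolP; left.
move=> /asboolP hx /asboolP hy; apply/asboolP.
elim: hx => [|b u v Xu _ IH]; first by rewrite scaler0 add0r.
by rewrite scalerDr scalerA -addrA; right.
Qed.

HB.instance Definition _ X :=
  GRing.isSubmodClosed.Build A V (submod_span X)
    (GRing.submod_closed_semi (submod_span_closed X)).

(* [submodClosed] does not record closure under opposite, which
   [Quotient.quot] asks for *)
Definition subpred (W : submodClosed V) : {pred V} := fun x => x \in W.

Lemma subpred_closed W : zmod_closed (subpred W).
Proof.
split=> [|x y xW yW]; first exact: rpred0.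
by rewrite unfold_in /subpred -scaleN1r addrC; apply: rpredD => //; apply: rpredZ.
Qed.

HB.instance Definition _ W :=
  GRing.isZmodClosed.Build V (subpred W) (subpred_closed W).

Definition quotmod (W : submodClosed V) : Type := Quotient.quot (subpred W).
End Modules.

Section QuotLmod.
Variables (A : comNzRingType) (V : lmodType A) (W : submodClosed V).
HB.instance Definition _ := GRing.Zmodule.on (quotmod W).

Definition qclass (x : V) : quotmod W := \pi_(Quotient.quot (subpred W))%qT x.
Definition qrepr (x : quotmod W) : V := repr (x : Quotient.quot (subpred W)).
Definition qscale (a : A) (x : quotmod W) : quotmod W := qclass (a *: qrepr x).

Lemma qreprK x : qclass (qrepr x) = x.
Proof. exact: reprK. Qed.

Lemma qclass_eq x y : (qclass x == qclass y) = (x - y \in W).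
Proof. by rewrite -[RHS]/(x - y \in subpred W) Quotient.idealrBE. Qed.

Lemma qclassP x y : qclass x = qclass y <-> x - y \in W.
Proof. by rewrite -qclass_eq; split=> [->|/eqP]. Qed.

Lemma qclassB : {morph qclass : x y / x - y}.
Proof. by move=> x y; rewrite /qclass raddfB. Qed.

Lemma qscaleE a x : qscale a (qclass x) = qclass (a *: x).
Proof.
apply/qclassP; rewrite -scalerBr rpredZ //.
by apply/qclassP; rewrite qreprK.
Qed.

Lemma qclassD : {morph qclass : x y / x + y}.
Proof. by move=> x y; rewrite /qclass raddfD. Qed.

Fact qscaleA a b x : qscale a (qscale b x) = qscale (a * b) x.
Proof. by rewrite -(qreprK x) !qscaleE scalerA. Qed.
Fact qscale1 : left_id 1 qscale.
Proof. by move=> x; rewrite -(qreprK x) qscaleE scale1r. Qed.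
Fact qscaleDr : right_distributive qscale +%R.
Proof.
by move=> a x y; rewrite -(qreprK x) -(qreprK y) -qclassD !qscaleE scalerDr qclassD.
Qed.
Fact qscaleDl x : {morph qscale^~ x : a b / a + b}.
Proof. by move=> a b; rewrite -(qreprK x) !qscaleE scalerDl qclassD. Qed.

HB.instance Definition _ := GRing.Zmodule_isLmodule.Build A (quotmod W)
  qscaleA qscale1 qscaleDr qscaleDl.

Lemma qclass_linear : linear qclass.
Proof. by move=> a x y; rewrite qclassD -qscaleE. Qed.
HB.instance Definition _ := GRing.isLinear.Build A V (quotmod W) *:%R qclass
  qclass_linear.

Definition qlift (U : lmodType A) (f : V -> U) (x : quotmod W) : U := f (qrepr x).

Lemma qliftE (U : lmodType A) (f : {linear V -> U}) x :
  {in W, forall w, f w = 0} -> qlift f (qclass x) = f x.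
Proof.
move=> fW; apply/eqP; rewrite -subr_eq0 -linearB; apply/eqP/fW/qclassP.
by rewrite qreprK.
Qed.

Lemma qlift_linear (U : lmodType A) (f : {linear V -> U}) :
  {in W, forall w, f w = 0} -> linear (qlift f).
Proof.
move=> fW a x y; rewrite -(qreprK x) -(qreprK y) -linearP.
by rewrite !(qliftE _ fW) linearP.
Qed.
End QuotLmod.

Section FreeModule.
Variables (A : comNzRingType) (K : choiceType) (U : lmodType A) (F : K -> U).

Definition freelin (g : {malg A[K]}) : U := \sum_(k <- msupp g) g@_k *: F k.

Lemma freelinEw (g : {malg A[K]}) (d : {fset K}) : (msupp g `<=` d)%fset ->
  freelin g = \sum_(k <- d) g@_k *: F k.
Proof.
move=> le_gd; rewrite /freelin (big_fset_incl _ le_gd) //= => k _.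
by move/mcoeff_outdom->; rewrite scale0r.
Qed.

Lemma freelin_linear : linear freelin.
Proof.
move=> a g h; pose d := (msupp g `|` msupp h `|` msupp (a *: g + h))%fset.
have gd : (msupp g `<=` d)%fset by apply/fsubsetP=> k; rewrite !in_fsetU => ->.
have hd : (msupp h `<=` d)%fset.
  by apply/fsubsetP=> k; rewrite !in_fsetU => ->; rewrite orbT.
have ghd : (msupp (a *: g + h) `<=` d)%fset.
  by apply/fsubsetP=> k; rewrite !in_fsetU => ->; rewrite orbT.
rewrite (freelinEw gd) (freelinEw hd) (freelinEw ghd).
rewrite scaler_sumr -big_split /=; apply: eq_bigr => k _.
by rewrite mcoeffD mcoeffZ scalerDl scalerA.
Qed.
HB.instance Definition _ := GRing.isLinear.Build A {malg A[K]} U *:%R freelin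
  freelin_linear.

Lemma freelinU k : freelin << k >> = F k.
Proof.
by rewrite (@freelinEw _ [fset k]%fset) ?msuppU_le // big_seq_fset1 mcoeffUU scale1r.
Qed.
End FreeModule.

(* Only nonnegative degrees. [Tagged] and [ecast] bridge the propositional
   equalities between degrees. *)
Record augdga (A : comNzRingType) := AugDGA {
  dg :> nat -> lmodType A;
  dgd : forall i, {linear dg i -> dg i.+1};
  dgmul : forall i j, dg i -> dg j -> dg (i + j)%N;
  dgone : dg 0%N;
  dgaug : forall i, {linear dg i -> A^o};
  _ : forall i (x : dg i), dgd i.+1 (dgd i x) = 0;
  _ : forall i j (y : dg j), linear (fun x : dg i => dgmul x y);
  _ : forall i j (x : dg i), linear (@dgmul i j x);
  _ : forall i j k (x : dg i) (y : dg j) (z : dg k),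
      Tagged dg (dgmul x (dgmul y z)) = Tagged dg (dgmul (dgmul x y) z);
  _ : forall i (x : dg i), Tagged dg (dgmul dgone x) = Tagged dg x;
  _ : forall i (x : dg i), Tagged dg (dgmul x dgone) = Tagged dg x;
  _ : forall i j (x : dg i) (y : dg j),
      dgd (i + j) (dgmul x y) = dgmul (dgd i x) y
        + (-1) ^+ i *: ecast m (dg m) (addnS i j) (dgmul x (dgd j y));
  _ : forall i (x : dg i.+1), dgaug i.+1 x = 0;
  _ : forall i j (x : dg i) (y : dg j),
      dgaug (i + j) (dgmul x y) = dgaug i x * dgaug j y;
  _ : dgaug 0 dgone = 1
}.

Section DGA.
Variables (A : comNzRingType) (C : augdga A).
Lemma dgmull i j (y : C j) : linear (fun x : C i => dgmul x y).
Proof. by case: C y. Qed.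
Lemma dgmulr i j (x : C i) : linear (@dgmul A C i j x).
Proof. by case: C x. Qed.
Lemma dgaugS i (x : C i.+1) : dgaug C i.+1 x = 0.
Proof. by case: C x. Qed.
Lemma dgaugM i j (x : C i) (y : C j) :
  dgaug C (i + j) (dgmul x y) = dgaug C i x * dgaug C j y.
Proof. by case: C x y. Qed.

Definition augker i : {pred C i} := fun c => dgaug C i c == 0.
Arguments augker : clear implicits.
Lemma augker_closed i : submod_closed (augker i).
Proof.
split=> [|a x y /eqP hx /eqP hy]; first by rewrite unfold_in /augker linear0.
by rewrite unfold_in /augker linearP hx hy scaler0 addr0.
Qed.
HB.instance Definition _ i :=
  GRing.isSubmodClosed.Build A (C i) (augker i)
    (GRing.submod_closed_semi (augker_closed i)).

Record augideal i := AugIdeal { aival : C i; _ : aival \in augker i }.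
HB.instance Definition _ i := [isSub for @aival i].
HB.instance Definition _ i := [Choice of augideal i by <:].
HB.instance Definition _ i := [SubChoice_isSubLmodule of augideal i by <:].

Definition bgen := {i : nat & augideal i}.
HB.instance Definition _ := Choice.on bgen.
Definition bgen0 : bgen := Tagged augideal (0 : augideal 0).

Definition deg (x : bgen) : nat := tag x.

Lemma bgen_d_subproof (x : bgen) : dgd C _ (aival (tagged x)) \in augker (deg x).+1.
Proof. by rewrite unfold_in /augker dgaugS. Qed.
Definition bgen_d (x : bgen) : bgen :=
  Tagged augideal (AugIdeal (bgen_d_subproof x)).

Lemma bgen_mul_subproof (x y : bgen) :
  dgmul (aival (tagged x)) (aival (tagged y)) \in augker (deg x + deg y).
Proof.
by rewrite unfold_in /augker dgaugM; case: (tagged x) => ? /= /eqP->; rewrite mul0r.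
Qed.
Definition bgen_mul (x y : bgen) : bgen :=
  Tagged augideal (AugIdeal (bgen_mul_subproof x y)).

(* The sum of all tensor powers of the augmentation ideal: the free module on
   lists of homogeneous elements, modulo linearity in every slot *)
Definition multilinear_rel (r : {malg A[seq bgen]}) : Prop :=
  exists (s1 s2 : seq bgen) i a (u v : augideal i),
    r = << s1 ++ Tagged augideal (a *: u + v) :: s2 >>
        - (a *: << s1 ++ Tagged augideal u :: s2 >>
           + << s1 ++ Tagged augideal v :: s2 >>).

Definition bar : Type := quotmod (submod_span multilinear_rel).
HB.instance Definition _ := GRing.Lmodule.on bar.

(* (c_1|...|c_p) *)
Definition tens (s : seq bgen) : bar := qclass _ << s >>.

Definition multilinear (U : lmodType A) (F : seq bgen -> U) : Prop :=
  forall s1 s2 i a (u v : augideal i),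
    F (s1 ++ Tagged augideal (a *: u + v) :: s2) =
    a *: F (s1 ++ Tagged augideal u :: s2) + F (s1 ++ Tagged augideal v :: s2).

Lemma tens_multilinear : multilinear tens.
Proof.
move=> s1 s2 i a u v; rewrite /tens -linearP; apply/qclassP/asboolP.
rewrite -[X in spanned _ X]addr0 -[X in X + 0]scale1r.
by right; [exists s1, s2, i, a, u, v | left].
Qed.

Lemma tens0 s1 s2 i : tens (s1 ++ Tagged augideal (0 : augideal i) :: s2) = 0.
Proof.
have := tens_multilinear s1 s2 (-1) (0 : augideal i) 0.
by rewrite scaler0 addr0 scaleN1r addNr.
Qed.

Definition barlift (U : lmodType A) (F : seq bgen -> U) : bar -> U :=
  qlift (freelin F).

Lemma barlift_rel (U : lmodType A) (F : seq bgen -> U) : multilinear F ->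
  {in submod_span multilinear_rel, forall w, freelin F w = 0}.
Proof.
move=> mF w /asboolP; elim=> [|a x y [s1 [s2 [i [b [u [v ->]]]]]] _ IH].
  exact: linear0.
rewrite linearP /= IH addr0 !(linearB, linearD, linearZ) /= !freelinU mF.
by rewrite -scalerDr scalerN addrACA !subrr addr0 scaler0.
Qed.

Lemma barlift_tens (U : lmodType A) (F : seq bgen -> U) s :
  multilinear F -> barlift F (tens s) = F s.
Proof.
move=> mF; rewrite /barlift (qliftE _ (barlift_rel mF)); exact: freelinU.
Qed.

Lemma barlift_linear (U : lmodType A) (F : seq bgen -> U) :
  multilinear F -> linear (barlift F).
Proof. by move=> mF; apply: qlift_linear; apply: barlift_rel. Qed.

(* Positions i are counted from 0. With positions counted from 1, the k-th term
   of d_1 has exponent (k - 1) + |c_1| + ... + |c_(k-1)|, which is i = k - 1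
   here, and the k-th term of d_2 has exponent k + |c_1| + ... + |c_k|, which is
   i.+1 = k. *)
Definition bar_sign (i : nat) (s : seq bgen) : A :=
  (-1) ^+ (i + sumn (take i [seq deg c | c <- s])).

Definition bar_d1 (s : seq bgen) : bar :=
  - \sum_(i < size s) bar_sign i s *:
      tens (take i s ++ bgen_d (nth bgen0 s i) :: drop i.+1 s).

Definition bar_d2 (s : seq bgen) : bar :=
  - \sum_(i < (size s).-1) bar_sign i.+1 s *:
      tens (take i s ++ bgen_mul (nth bgen0 s i) (nth bgen0 s i.+1) :: drop i.+2 s).

Lemma bgen_d_linear i a (u v : augideal i) :
  bgen_d (Tagged augideal (a *: u + v)) = Tagged augideal
    (a *: tagged (bgen_d (Tagged augideal u)) + tagged (bgen_d (Tagged augideal v))).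
Proof. by congr (Tagged augideal _); apply: val_inj; rewrite /= linearP. Qed.

Lemma bgen_mull i a (u v : augideal i) y :
  bgen_mul (Tagged augideal (a *: u + v)) y = Tagged augideal
    (a *: tagged (bgen_mul (Tagged augideal u) y)
     + tagged (bgen_mul (Tagged augideal v) y)).
Proof. by congr (Tagged augideal _); apply: val_inj; rewrite /= dgmull. Qed.

Lemma bgen_mulr i a (u v : augideal i) y :
  bgen_mul y (Tagged augideal (a *: u + v)) = Tagged augideal
    (a *: tagged (bgen_mul y (Tagged augideal u))
     + tagged (bgen_mul y (Tagged augideal v))).
Proof. by congr (Tagged augideal _); apply: val_inj; rewrite /= dgmulr. Qed.

Lemma bar_sign_slot i s1 s2 (x y : bgen) : deg x = deg y ->
  bar_sign i (s1 ++ x :: s2) = bar_sign i (s1 ++ y :: s2).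
Proof. by rewrite /bar_sign !map_cat /= => ->. Qed.

Lemma drop_catl (T : Type) (s t : seq T) k :
  (k <= size s)%N -> drop k (s ++ t) = drop k s ++ t.
Proof.
by rewrite drop_cat; case: ltngtP => // -> _; rewrite subnn drop_size drop0.
Qed.
Lemma take_catr (T : Type) (s t : seq T) k : take (size s + k) (s ++ t) = s ++ take k t.
Proof. by elim: s => //= x s ->. Qed.
Lemma drop_catr (T : Type) (s t : seq T) k : drop (size s + k) (s ++ t) = drop k t.
Proof. by elim: s => //= x s ->. Qed.
Lemma nth_catr (T : Type) x0 (s t : seq T) k : nth x0 (s ++ t) (size s + k) = nth x0 t k.
Proof. by elim: s => //= x s ->. Qed.

Lemma bar_d1_multilinear : multilinear bar_d1.
Proof.
move=> s1 s2 i a u v; rewrite /bar_d1 scalerN -opprD !size_cat /=; congr (- _).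
rewrite scaler_sumr -big_split /=; apply: eq_bigr => -[k /= ltk] _.
rewrite !(@bar_sign_slot k s1 s2 (Tagged augideal (_ *: _ + _)) (Tagged augideal v)) //.
rewrite !(@bar_sign_slot k s1 s2 (Tagged augideal u) (Tagged augideal v)) //.
rewrite scalerA mulrC -scalerA -scalerDr; congr (_ *: _).
case: (ltngtP k (size s1)) => [lt_k|gt_k|->].
- rewrite !takel_cat ?(ltnW lt_k) // !nth_cat lt_k !drop_catl //.
  by rewrite -!cat_cons !catA tens_multilinear.
- have [m ->] : exists m, k = (size s1 + m.+1)%N.
    by exists (k - size s1).-1; rewrite prednK ?subn_gt0 // subnKC // ltnW.
  by rewrite -addnS !take_catr !nth_catr !drop_catr -!catA /= tens_multilinear.
- by rewrite -[size s1]addn0 -addnS !take_catr !nth_catr !drop_catr /= !cats0 !drop0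
    bgen_d_linear tens_multilinear.
Qed.

Lemma bar_d2_multilinear : multilinear bar_d2.
Proof.
move=> s1 s2 i a u v; rewrite /bar_d2 scalerN -opprD !size_cat /=; congr (- _).
rewrite scaler_sumr -big_split /=; apply: eq_bigr => -[k /= ltk] _.
rewrite !(@bar_sign_slot k.+1 s1 s2 (Tagged augideal (_ *: _ + _)) (Tagged augideal v)) //.
rewrite !(@bar_sign_slot k.+1 s1 s2 (Tagged augideal u) (Tagged augideal v)) //.
rewrite scalerA mulrC -scalerA -scalerDr; congr (_ *: _).
case: (ltngtP k (size s1)) => [lt_k|gt_k|->].
- rewrite !takel_cat ?(ltnW lt_k) // !nth_cat lt_k.
  case: (ltngtP k.+1 (size s1)) lt_k => // [lt_k1|eq_k1] _.
    by rewrite !drop_catl // -!cat_cons !catA tens_multilinear.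
  by rewrite -[k.+2]add1n eq_k1 subnn addnC !drop_catr /= !drop0 bgen_mulr tens_multilinear.
- have [m ->] : exists m, k = (size s1 + m.+1)%N.
    by exists (k - size s1).-1; rewrite prednK ?subn_gt0 // subnKC // ltnW.
  by rewrite -!addnS !take_catr !nth_catr !drop_catr -!catA /= tens_multilinear.
- by rewrite -[size s1]addn0 -!addnS !take_catr !nth_catr !drop_catr /= !cats0
    bgen_mull tens_multilinear.
Qed.

Definition bar_d (x : bar) : bar := barlift (fun s => bar_d1 s + bar_d2 s) x.

Lemma bar_d_multilinear : multilinear (fun s => bar_d1 s + bar_d2 s).
Proof.
move=> s1 s2 i a u v.
by rewrite bar_d1_multilinear bar_d2_multilinear addrACA -scalerDr.
Qed.

Lemma bar_d_tens s : bar_d (tens s) = bar_d1 s + bar_d2 s.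
Proof. exact/barlift_tens/bar_d_multilinear. Qed.

HB.instance Definition _ := GRing.isLinear.Build A bar bar *:%R bar_d
  (barlift_linear bar_d_multilinear).

Lemma bar_linear_ext (U : lmodType A) (f g : {linear bar -> U}) :
  (forall s, f (tens s) = g (tens s)) -> f =1 g.
Proof.
move=> eq_fg x; rewrite -(qreprK x) [qrepr x]monalgE !linear_sum.
apply: eq_bigr => s _; set c := (qrepr x)@_s.
have -> : << c *g s >> = c *: << s >> :> {malg A[seq bgen]}.
  by apply/malgP => t; rewrite mcoeffZ !mcoeffU mulrnAr mulr1.
by rewrite !linearZ /=; congr (_ *: _); apply: eq_fg.
Qed.

Definition tens_deg (s : seq bgen) : int := \sum_(c <- s) ((deg c)%:Z - 1).

Definition bar_in (k : int) : {pred bar} :=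
  submod_span (fun x => exists2 s, tens_deg s = k & x = tens s).
HB.instance Definition _ k := GRing.SubmodClosed.on (bar_in k).

Lemma bar_in_tens s : tens s \in bar_in (tens_deg s).
Proof.
by apply/asboolP; rewrite -[tens s]scale1r -[_ *: _]addr0; right; [exists s | left].
Qed.

Lemma tens_deg_cat s t : tens_deg (s ++ t) = tens_deg s + tens_deg t.
Proof. exact: big_cat. Qed.

Lemma bar_d_in k x : x \in bar_in k -> bar_d x \in bar_in (k + 1).
Proof.
move=> /asboolP; elim=> [|a y z [s <- ->] _ IH]; first by rewrite linear0 rpred0.
rewrite linearP /= rpredD // rpredZ // bar_d_tens /bar_d1 /bar_d2.
rewrite -opprD -scaleN1r rpredZ // rpredD // rpred_sum // => -[i /= lti] _; rewrite rpredZ //.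
  set t := _ ++ _; suff -> : tens_deg s + 1 = tens_deg t by apply: bar_in_tens.
  rewrite -[in LHS](cat_take_drop i s) (drop_nth bgen0) // /t !tens_deg_cat.
  rewrite /tens_deg !big_cons /=; move: (\sum_(j <- _) _) (\sum_(j <- _) _) => u v.
  by rewrite /deg /=; lia.
have lti1 : (i.+1 < size s)%N by case: (size s) lti.
set t := _ ++ _; suff -> : tens_deg s + 1 = tens_deg t by apply: bar_in_tens.
rewrite -[in LHS](cat_take_drop i s) (drop_nth bgen0) 1?ltnW // (drop_nth bgen0 lti1) /t.
rewrite !tens_deg_cat /tens_deg !big_cons /=.
by move: (\sum_(j <- _) _) (\sum_(j <- _) _) => u v; rewrite /deg /=; lia.
Qed.

Definition cocycle (k : int) : {pred bar} :=
  fun x => (x \in bar_in k) && (bar_d x == 0).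
Lemma cocycle_closed k : submod_closed (cocycle k).
Proof.
split=> [|a x y]; first by rewrite unfold_in /cocycle rpred0 linear0 eqxx.
move=> /andP[xk /eqP dx] /andP[yk /eqP dy]; rewrite unfold_in /cocycle.
by rewrite linearP /= dx dy scaler0 addr0 eqxx rpredD // rpredZ.
Qed.
HB.instance Definition _ k := GRing.isSubmodClosed.Build A bar (cocycle k)
  (GRing.submod_closed_semi (cocycle_closed k)).

Record cocycles k := Cocycle { cocval : bar; _ : cocval \in cocycle k }.
HB.instance Definition _ k := [isSub for @cocval k].
HB.instance Definition _ k := [Choice of cocycles k by <:].
HB.instance Definition _ k := [SubChoice_isSubLmodule of cocycles k by <:].

Definition coboundary k : {pred cocycles k} :=
  fun z => `[< exists2 b, b \in bar_in (k - 1) & bar_d b = cocval z >].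
Lemma coboundary_closed k : submod_closed (@coboundary k).
Proof.
split=> [|a x y /asboolP[b bk db] /asboolP[c ck dc]]; apply/asboolP.
  by exists 0; rewrite ?rpred0 ?linear0.
by exists (a *: b + c); rewrite ?rpredD ?rpredZ // linearP /= db dc.
Qed.
HB.instance Definition _ k := GRing.isSubmodClosed.Build A (cocycles k)
  (@coboundary k) (GRing.submod_closed_semi (@coboundary_closed k)).

Definition Hbar (k : int) : Type := quotmod (@coboundary k).
HB.instance Definition _ k := GRing.Lmodule.on (Hbar k).

(* A total function: 0 if [x] is not a cocycle of degree [k]. Over a graph every
   element of degree 0 is a cocycle, see [bar0_cocycle]. *)
Definition hclass (k : int) (x : bar) : Hbar k :=
  qclass _ (insubd (0 : cocycles k) x).

Definition cohomologous (k : int) (x y : bar) : Prop :=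
  exists2 b, b \in bar_in (k - 1) & bar_d b = x - y.
End DGA.
Arguments augker {A} C i _.
Arguments bar_in {A C} k _.
Arguments cocycle {A C} k _.
Arguments coboundary {A} C k _.
Arguments hclass {A C} k x.
Arguments cohomologous {A C} k x y.

Record dgmorph (A : comNzRingType) (C D : augdga A) := DGMorph {
  dgm :> forall i, {linear C i -> D i};
  _ : forall i (x : C i), dgm i.+1 (dgd C i x) = dgd D i (dgm i x);
  _ : forall i j (x : C i) (y : C j),
      dgm (i + j) (dgmul x y) = dgmul (dgm i x) (dgm j y);
  _ : dgm 0 (dgone C) = dgone D;
  _ : forall i (x : C i), dgaug D i (dgm i x) = dgaug C i x
}.

Section Functoriality.
Variables (A : comNzRingType) (C D : augdga A) (phi : dgmorph C D).

Lemma dgm_d i x : phi i.+1 (dgd C i x) = dgd D i (phi i x).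
Proof. by case: phi x. Qed.
Lemma dgmM i j (x : C i) (y : C j) :
  phi (i + j)%N (dgmul x y) = dgmul (phi i x) (phi j y).
Proof. by case: phi x y. Qed.
Lemma dgm_aug i (x : C i) : dgaug D i (phi i x) = dgaug C i x.
Proof. by case: phi x. Qed.

Lemma bgen_map_subproof (x : bgen C) :
  phi (deg x) (aival (tagged x)) \in augker D (deg x).
Proof. by rewrite unfold_in /augker dgm_aug; case: (tagged x). Qed.
Definition bgen_map (x : bgen C) : bgen D :=
  Tagged (augideal D) (AugIdeal (bgen_map_subproof x)).

Definition bar_map : bar C -> bar D := barlift (fun s => tens (map bgen_map s)).

Lemma bar_map_multilinear : multilinear (fun s => tens (map bgen_map s)).
Proof.
move=> s1 s2 i a u v; rewrite !map_cat /= -tens_multilinear.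
congr (tens (_ ++ Tagged _ _ :: _)); apply: val_inj; exact: linearP.
Qed.

HB.instance Definition _ := GRing.isLinear.Build A (bar C) (bar D) *:%R bar_map
  (barlift_linear bar_map_multilinear).

Lemma bar_map_tens s : bar_map (tens s) = tens (map bgen_map s).
Proof. exact/barlift_tens/bar_map_multilinear. Qed.

Lemma bgen_map_d x : bgen_map (bgen_d x) = bgen_d (bgen_map x).
Proof. by congr (Tagged _ _); apply: val_inj; apply: dgm_d. Qed.

Lemma bgen_map_mul x y : bgen_map (bgen_mul x y) = bgen_mul (bgen_map x) (bgen_map y).
Proof. by congr (Tagged _ _); apply: val_inj; apply: dgmM. Qed.

Lemma bar_sign_map i s : bar_sign i (map bgen_map s) = bar_sign i s.
Proof. by rewrite /bar_sign -map_comp. Qed.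

Lemma bar_map_d x : bar_map (bar_d x) = bar_d (bar_map x).
Proof.
apply: (bar_linear_ext (f := bar_map \o @bar_d A C) (g := @bar_d A D \o bar_map)) => s /=.
rewrite bar_map_tens !bar_d_tens /bar_d1 /bar_d2 size_map.
rewrite linearD !linearN !(linear_sum bar_map).
congr (- _ - _).
  apply: eq_bigr => -[i /= lti] _; rewrite linearZ /= bar_map_tens bar_sign_map.
  by rewrite map_cat /= map_take map_drop bgen_map_d (nth_map (bgen0 C)).
apply: eq_bigr => -[i /= lti] _; rewrite linearZ /= bar_map_tens bar_sign_map.
have lti1 : (i.+1 < size s)%N by case: (size s) lti.
rewrite map_cat /= map_take map_drop bgen_map_mul !(nth_map (bgen0 C)) //.
exact: ltnW.
Qed.

Lemma bar_map_in k x : x \in bar_in k -> bar_map x \in bar_in k.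
Proof.
move=> /asboolP; elim=> [|a y z [s sk ->] _ IH]; first by rewrite linear0 rpred0.
rewrite linearP /= rpredD ?rpredZ // bar_map_tens -sk.
have -> : tens_deg s = tens_deg (map bgen_map s) by rewrite /tens_deg big_map.
exact: bar_in_tens.
Qed.

Lemma cocycle_map_subproof k (z : cocycles C k) : bar_map (cocval z) \in cocycle k.
Proof.
case: z => x /= /andP[xk /eqP dx].
by rewrite unfold_in /cocycle bar_map_in // -bar_map_d dx linear0 eqxx.
Qed.
Definition cocycle_map k (z : cocycles C k) : cocycles D k :=
  Cocycle (cocycle_map_subproof z).

Lemma cocycle_map_linear k : linear (@cocycle_map k).
Proof. by move=> a x y; apply: val_inj; apply: linearP. Qed.
HB.instance Definition _ k := GRing.isLinear.Build A (cocycles C k) (cocycles D k)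
  *:%R (@cocycle_map k) (@cocycle_map_linear k).

Definition Hbar_map k : Hbar C k -> Hbar D k := qlift (qclass _ \o @cocycle_map k).

Lemma Hbar_map_rel k : {in coboundary C k, forall z,
  (qclass (coboundary D k) \o @cocycle_map k) z = 0}.
Proof.
move=> z /asboolP[b bk db] /=; rewrite -(linear0 (qclass _)); apply/qclassP.
rewrite subr0; apply/asboolP; exists (bar_map b); first exact: bar_map_in.
by rewrite -bar_map_d db.
Qed.

Lemma Hbar_map_linear k : linear (@Hbar_map k).
Proof. by apply: qlift_linear; apply: Hbar_map_rel. Qed.
HB.instance Definition _ k := GRing.isLinear.Build A (Hbar C k) (Hbar D k)
  *:%R (@Hbar_map k) (@Hbar_map_linear k).
End Functoriality.

(* Pointed finite 1-dimensional simplicial sets, given by their nondegenerate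
   simplices, and their normalized cochain algebras *)
Record ptgraph := PtGraph {
  vert : finType;
  edge : finType;
  gsrc : edge -> vert;
  gtgt : edge -> vert;
  gbase : vert
}.

Definition simplices (X : ptgraph) (i : nat) : finType :=
  match i with 0 => vert X | 1 => edge X | _ => void end.

Section Cochains.
Variables (A : comNzRingType) (X : ptgraph).

Definition coch (i : nat) : lmodType A := {ffun simplices X i -> A^o}.

Definition coch_d (i : nat) : coch i -> coch i.+1 :=
  match i return coch i -> coch i.+1 with
  | 0 => fun f : {ffun vert X -> A^o} =>
           [ffun e : edge X => f (gtgt e) - f (gsrc e)]
  | _ => fun=> 0
  end.

Definition coch_mul (i j : nat) : coch i -> coch j -> coch (i + j)%N :=
  match i, j return coch i -> coch j -> coch (i + j)%N with
  | 0, 0 => fun f g : {ffun vert X -> A^o} => [ffun v : vert X => f v * g v]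
  | 0, 1 => fun (f : {ffun vert X -> A^o}) (a : {ffun edge X -> A^o}) =>
              [ffun e : edge X => f (gsrc e) * a e]
  | 1, 0 => fun (a : {ffun edge X -> A^o}) (f : {ffun vert X -> A^o}) =>
              [ffun e : edge X => f (gtgt e) * a e]
  | _, _ => fun _ _ => 0
  end.

Definition coch_one : coch 0 := [ffun=> 1].

Definition coch_aug (i : nat) : coch i -> A^o :=
  match i return coch i -> A^o with
  | 0 => fun f : {ffun vert X -> A^o} => f (gbase X)
  | _ => fun=> 0
  end.

Lemma coch_d_linear i : linear (@coch_d i).
Proof.
case: i => [|i] a x y; last by rewrite /= scaler0 addr0.
by apply/ffunP => e; rewrite !ffunE scalerBr opprD addrACA.
Qed.
HB.instance Definition _ i := GRing.isLinear.Build A (coch i) (coch i.+1) *:%R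
  (@coch_d i) (@coch_d_linear i).

Lemma coch_aug_linear i : linear (@coch_aug i).
Proof. by case: i => [|i] a x y; rewrite /= ?scaler0 ?addr0 // !ffunE. Qed.
HB.instance Definition _ i := GRing.isLinear.Build A (coch i) A^o *:%R
  (@coch_aug i) (@coch_aug_linear i).

Lemma coch_ge2 i (x y : coch i) : (1 < i)%N -> x = y.
Proof. by case: i x y => [|[|i]] // x y _; apply/ffunP; case. Qed.

Lemma coch_ge2_tagged i j (x : coch i) (y : coch j) :
  i = j -> (1 < i)%N -> Tagged coch x = Tagged coch y.
Proof. by move=> eq_ij; case: j / eq_ij y => y i2; rewrite (coch_ge2 x y). Qed.

Lemma coch_dd i (x : coch i) : coch_d (coch_d x) = 0.
Proof. exact: coch_ge2. Qed.

Lemma coch_mull i j (y : coch j) : linear (fun x : coch i => coch_mul x y).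
Proof.
move=> a u v; case: i j u v y => [|[|i]] [|[|j]] u v y /=;
  try (by rewrite ?scaler0 ?addr0); try (exact: coch_ge2);
  apply/ffunP => e; rewrite !ffunE;
  by rewrite ?mulrDr ?mulrDl -?scalerAl -?scalerAr.
Qed.

Lemma coch_mulr i j (x : coch i) : linear (@coch_mul i j x).
Proof.
move=> a u v; case: i j u v x => [|[|i]] [|[|j]] u v x /=;
  try (by rewrite ?scaler0 ?addr0); try (exact: coch_ge2);
  apply/ffunP => e; rewrite !ffunE;
  by rewrite ?mulrDr ?mulrDl -?scalerAl -?scalerAr.
Qed.

Lemma coch_mulA i j k (x : coch i) (y : coch j) (z : coch k) :
  Tagged coch (coch_mul x (coch_mul y z)) = Tagged coch (coch_mul (coch_mul x y) z).
Proof.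
have [lt2|] := ltnP 1 (i + (j + k)); first by apply: coch_ge2_tagged => //; rewrite addnA.
case: i x => [|[|i]] x; case: j y => [|[|j]] y; case: k z => [|[|k]] z // _.
all: congr (Tagged coch _); apply/ffunP => e; rewrite !ffunE.
- exact: mulrA.
- exact: mulrA.
- exact: mulrCA.
- by rewrite mulrA [y _ * _]mulrC.
Qed.

Lemma coch_mul1 i (x : coch i) : Tagged coch (coch_mul coch_one x) = Tagged coch x.
Proof.
case: i x => [|[|i]] x; last by apply: coch_ge2_tagged; rewrite ?add0n.
  by congr (Tagged coch _); apply/ffunP => v; rewrite !ffunE mul1r.
by congr (Tagged coch _); apply/ffunP => v; rewrite !ffunE mul1r.
Qed.

Lemma coch_1mul i (x : coch i) : Tagged coch (coch_mul x coch_one) = Tagged coch x.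
Proof.
case: i x => [|[|i]] x; last by apply: coch_ge2_tagged; rewrite ?addn0.
  by congr (Tagged coch _); apply/ffunP => v; rewrite !ffunE mulr1.
by congr (Tagged coch _); apply/ffunP => v; rewrite !ffunE mul1r.
Qed.

Lemma coch_leibniz i j (x : coch i) (y : coch j) :
  coch_d (coch_mul x y) = coch_mul (coch_d x) y
    + (-1) ^+ i *: ecast m (coch m) (addnS i j) (coch_mul x (coch_d y)).
Proof.
have [gt0|] := ltnP 0 (i + j); first exact: coch_ge2.
case: i x => [|i] x; last by [].
case: j y => [|j] y // _; rewrite (eq_irrelevance (addnS 0 0) erefl) scale1r.
apply/ffunP => e; rewrite !ffunE mulrBr mulrBr addrA.
by rewrite [y (gtgt e) * _]mulrC [y (gtgt e) * _]mulrC subrK.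
Qed.

Lemma coch_augS i (x : coch i.+1) : coch_aug x = 0.
Proof. by []. Qed.

Lemma coch_augM i j (x : coch i) (y : coch j) :
  coch_aug (coch_mul x y) = coch_aug x * coch_aug y.
Proof.
case: i x => [|[|i]] x; case: j y => [|[|j]] y; rewrite /= ?mul0r ?mulr0 //.
by rewrite ffunE.
Qed.

Lemma coch_aug1 : coch_aug coch_one = 1.
Proof. by rewrite /= ffunE. Qed.

Definition cochains : augdga A :=
  @AugDGA A coch (fun i => @coch_d i) coch_mul coch_one (fun i => @coch_aug i)
    coch_dd coch_mull coch_mulr coch_mulA coch_mul1 coch_1mul coch_leibniz
    coch_augS coch_augM coch_aug1.
End Cochains.

Section DegreeZero.
Variables (A : comNzRingType) (X : ptgraph).
Local Notation C := (cochains A X).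

Lemma tens_deg_gt0 (s : seq (bgen C)) : (0 < tens_deg s)%R ->
  exists s1 x s2, s = s1 ++ x :: s2 /\ (1 < deg x)%N.
Proof.
elim: s => [|x s IH]; first by rewrite /tens_deg big_nil.
rewrite /tens_deg big_cons; have [x2 _|x1 s0] := ltnP 1 (deg x).
  by exists [::], x, s.
have [|s1 [y [s2 [-> y2]]]] := IH; last by exists (x :: s1), y, s2.
by rewrite /tens_deg; move: (\sum_(j <- s) _) s0 => u; lia.
Qed.

Lemma bar_in_gt0 (k : int) (x : bar C) : (0 < k)%R -> x \in bar_in k -> x = 0.
Proof.
move=> k0 /asboolP; elim=> // a y z [s sk ->] _ ->; rewrite addr0.
have [|s1 [[i u] [s2 [-> i2]]]] := @tens_deg_gt0 s; first by rewrite sk.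
have -> : u = 0 by apply: val_inj; apply: coch_ge2.
by rewrite tens0 scaler0.
Qed.

Lemma bar0_cocycle (x : bar C) : x \in bar_in 0 -> x \in cocycle 0.
Proof.
move=> x0; rewrite unfold_in /cocycle x0 /=.
by apply/eqP/(@bar_in_gt0 1) => //; rewrite -[1]add0r; apply: bar_d_in.
Qed.
End DegreeZero.

(* An edge may be sent to the degenerate edge of a vertex ([inr]). *)
Record ptgraph_map (X Y : ptgraph) := PtGraphMap {
  mvert : vert X -> vert Y;
  medge : edge X -> edge Y + vert Y;
  _ : mvert (gbase X) = gbase Y;
  _ : forall e : edge X,
      match medge e with
      | inl e' => mvert (gsrc e) = gsrc e' /\ mvert (gtgt e) = gtgt e'
      | inr v => mvert (gsrc e) = v /\ mvert (gtgt e) = v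
      end
}.

Section Pullback.
Variables (A : comNzRingType) (X Y : ptgraph) (phi : ptgraph_map X Y).

Definition pull (i : nat) : coch A Y i -> coch A X i :=
  match i return coch A Y i -> coch A X i with
  | 0 => fun f : {ffun vert Y -> A^o} => [ffun v : vert X => f (mvert phi v)]
  | 1 => fun a : {ffun edge Y -> A^o} =>
           [ffun e : edge X => (if medge phi e is inl e' then a e' else 0) : A^o]
  | _ => fun=> 0
  end.

Lemma pull_linear i : linear (@pull i).
Proof.
case: i => [|[|i]] a x y; last exact: coch_ge2.
  by apply/ffunP => v; rewrite !ffunE.
apply/ffunP => e; rewrite !ffunE.
by case: (medge phi e) => [?|?]; rewrite ?ffunE ?scaler0 ?addr0.
Qed.
HB.instance Definition _ i := GRing.isLinear.Build A (coch A Y i) (coch A X i) *:%R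
  (@pull i) (@pull_linear i).

Lemma pull_d i (x : coch A Y i) : pull (coch_d x) = coch_d (pull x).
Proof.
case: i x => [|i] x; last exact: coch_ge2.
apply/ffunP => e; rewrite !ffunE; case: phi => mv me /= _ /(_ e).
by case: (me e) => [e'|v] [-> ->]; rewrite ?ffunE ?subrr.
Qed.

Lemma pullM i j (x : coch A Y i) (y : coch A Y j) :
  pull (coch_mul x y) = coch_mul (pull x) (pull y).
Proof.
have [ge2|] := ltnP 1 (i + j); first exact: coch_ge2.
case: i x => [|[|i]] x; case: j y => [|[|j]] y // _; apply/ffunP => e; rewrite !ffunE //.
all: case: phi => mv me /= _ /(_ e).
all: by case: (me e) => [e'|v] [s t]; rewrite ?ffunE ?mulr0 ?s ?t.
Qed.

Lemma pull1 : pull (coch_one A Y) = coch_one A X.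
Proof. by apply/ffunP => v; rewrite !ffunE. Qed.

Lemma pull_aug i (x : coch A Y i) : coch_aug (pull x) = coch_aug x.
Proof. by case: i x => [|i] x //=; rewrite ffunE; case: phi => mv me /= ->. Qed.

Definition pullback : dgmorph (cochains A Y) (cochains A X) :=
  @DGMorph A (cochains A Y) (cochains A X) (fun i => @pull i)
    pull_d pullM pull1 pull_aug.
End Pullback.

Section OneForms.
Variables (A : comNzRingType) (X : ptgraph).

Lemma form_subproof (a : coch A X 1) : (a : cochains A X 1) \in augker (cochains A X) 1.
Proof. exact: eqxx. Qed.
Definition form (a : coch A X 1) : bgen (cochains A X) :=
  Tagged (augideal (cochains A X)) (AugIdeal (form_subproof a)).

(* (alpha_1|...|alpha_m) for 1-cochains alpha_i *)
Definition tens1 (s : seq (coch A X 1)) : bar (cochains A X) := tens (map form s).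

(* (alpha_1|...|alpha_(k-1) u F|alpha_(k+1)|...) and
   (alpha_1|...|alpha_(k-1)|F u alpha_(k+1)|...), or 0 when the factor of F is
   missing; s1 = alpha_1, ..., alpha_(k-1) and s2 = alpha_(k+1), ..., alpha_m. *)
Definition cup_left (s1 : seq (coch A X 1)) (F : coch A X 0) (s2 : seq (coch A X 1)) :
    bar (cochains A X) :=
  if s1 is a :: s then tens1 (belast a s ++ coch_mul (last a s) F :: s2) else 0.
Definition cup_right (s1 : seq (coch A X 1)) (F : coch A X 0) (s2 : seq (coch A X 1)) :
    bar (cochains A X) :=
  if s2 is b :: s then tens1 (s1 ++ coch_mul F b :: s) else 0.
End OneForms.

Definition circle : ptgraph :=
  {| vert := unit; edge := unit; gsrc := fun=> tt; gtgt := fun=> tt; gbase := tt |}.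

Section Loop.
Variables (S : Type) (n : nat) (w : 'I_n -> S + S).

(* The letter w(i), 1 <= i <= n, is [w k] with [i = lift ord0 k]; [inl] is a
   letter in S and [inr] one in S^-1. *)
Definition positive (i : 'I_n.+1) : bool :=
  if unlift ord0 i is Some k then (if w k is inl _ then true else false) else true.

Definition loop : ptgraph := {|
  vert := 'I_n.+1;
  edge := 'I_n.+1;
  gsrc := fun i => if positive i then i else ordS i;
  gtgt := fun i => if positive i then ordS i else i;
  gbase := ord0
|}.

Lemma collapse_subproof (e : edge loop) :
  match (if e == ord0 then inl tt else inr tt : edge circle + vert circle) with
  | inl e' => tt = @gsrc circle e' /\ tt = @gtgt circle e'
  | inr v => tt = v /\ tt = v
  end.
Proof. by case: eqP. Qed.
Definition collapse : ptgraph_map loop circle :=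
  @PtGraphMap loop circle (fun=> tt) (fun e => if e == ord0 then inl tt else inr tt)
    (erefl tt) collapse_subproof.

Section Forms.
Variable A : comNzRingType.
Local Notation C := (cochains A loop).

Lemma loop_dE (f : coch A loop 0) (i : 'I_n.+1) :
  (coch_d f : coch A loop 1) i =
  (if positive i then 1 else -1) * ((f : {ffun 'I_n.+1 -> A^o}) (ordS i) - f i).
Proof. by rewrite !ffunE /=; case: (positive i); rewrite ?mul1r ?mulN1r ?opprB. Qed.

(* A[t] -> H^0_Bar(circle), t^p |-> [(tau|...|tau)] *)
Definition circle_class (p : {poly A}) : Hbar (cochains A circle) 0 :=
  hclass 0 (\sum_(i < size p) p`_i *: tens1 (nseq i ([ffun=> 1] : coch A circle 1))).

Definition loop_class (p : {poly A}) : Hbar C 0 :=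
  Hbar_map (pullback A collapse) (circle_class p).

Definition delta0 : coch A loop 1 := [ffun i : 'I_n.+1 => (i == ord0)%:R : A^o].

Definition delta0_poly (p : {poly A}) : bar C :=
  \sum_(i < size p) p`_i *: tens1 (nseq i delta0).

(* As for w, f_i is [f k] with [i = lift ord0 k], i.e. i = k + 1. *)
Implicit Types f g : {ffun 'I_n -> A}.

Definition fdx f : coch A loop 1 :=
  [ffun i : 'I_n.+1 =>
     (if unlift ord0 i is Some k then (if positive i then f k else - f k) else 0) : A^o].

(* The integral of f dx from i to j, which by convention is 0 for i = 0 *)
Definition int_dx f (i j : nat) : A :=
  if i == 0%N then 0 else \sum_(k < n | (i <= k.+1 < j)%N) f k.

Definition int_word f : A := \sum_(k < n) f k.

Definition cobound f : coch A loop 0 :=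
  [ffun j : 'I_n.+1 => (if j == ord0 then 0 else int_dx f 1 j - int_word f) : A^o].

(* the functions i |-> int_(d_1 i)^(n+1) f dx and i |-> int_(d_0 i)^(n+1) f dx on [n] *)
Definition int_from_tgt f (k : 'I_n) : A :=
  int_dx f (@gtgt loop (lift ord0 k) : 'I_n.+1) n.+1.
Definition int_from_src f (k : 'I_n) : A :=
  int_dx f (@gsrc loop (lift ord0 k) : 'I_n.+1) n.+1.
End Forms.
End Loop.

(* [EntT] stands for t = delta_0 and [EntDx f] for f dx; see [entry_form]. *)
Inductive entry (A : comNzRingType) (n : nat) :=
| EntT
| EntDx of {ffun 'I_n -> A}.
Arguments EntT {A n}.

Definition entry_code (A : comNzRingType) (n : nat) (e : entry A n) :=
  if e is EntDx f then Some f else None.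
Definition entry_decode (A : comNzRingType) (n : nat) (o : option {ffun 'I_n -> A}) :=
  if o is Some f then EntDx f else EntT.
Lemma entry_codeK A n : cancel (@entry_code A n) (@entry_decode A n).
Proof. by case. Qed.
HB.instance Definition _ A n := Choice.copy (entry A n) (can_type (@entry_codeK A n)).

Definition is_t (A : comNzRingType) (n : nat) (e : entry A n) : bool :=
  if e is EntT then true else false.
Definition modified_weight (A : comNzRingType) (n : nat) (s : seq (entry A n)) : nat :=
  size s - count (@is_t A n) s.

Section Reduction.
Variables (A : comNzRingType) (S : Type) (n : nat) (w : 'I_n -> S + S).
Implicit Types (f : {ffun 'I_n -> A}) (e : entry A n) (s : seq (entry A n)).

Definition entry_form e : coch A (loop w) 1 :=
  match e with EntT => delta0 w A | EntDx f => fdx w f end.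

Local Notation combination := {malg A[seq (entry A n)]}.

Definition bar_of (x : combination) : bar (cochains A (loop w)) :=
  freelin (fun s => tens1 (map entry_form s)) x.

(* alpha u d^-1(f dx) and d^-1(f dx) u alpha, as a scalar and an entry *)
Definition entry_cup_left e f : A * entry A n :=
  match e with
  | EntT => (- int_word f, EntT)
  | EntDx g => (1, EntDx [ffun k => - int_from_tgt w f k * g k])
  end.
Definition entry_cup_right f e : A * entry A n :=
  match e with
  | EntT => (0, EntT)
  | EntDx g => (1, EntDx [ffun k => - int_from_src w f k * g k])
  end.

(* The scalars of the cup products and the signs are moved into the first
   components. *)
Definition summands s1 f s2 : seq (A * seq (entry A n)) :=
  (int_word f, s1 ++ EntT :: s2)
  :: (if s1 is a :: s then
        let ca := entry_cup_left (last a s) f in [:: (- ca.1, belast a s ++ ca.2 :: s2)]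
      else [::])
  ++ (if s2 is b :: s then
        let cb := entry_cup_right f b in [:: (cb.1, s1 ++ cb.2 :: s)]
      else [::]).

Definition expansion s1 f s2 : combination :=
  \sum_(c <- summands s1 f s2) c.1 *: << c.2 >>.

(* [expansion] replaces one tensor, at any of its entries f dx; addition in
   [combination] collects like terms. *)
Definition reduces (x y : combination) : Prop :=
  exists s1 f s2, let s := s1 ++ EntDx f :: s2 in
    s \in msupp x /\ y = x - x@_s *: << s >> + x@_s *: expansion s1 f s2.

Definition halted (x : combination) : Prop :=
  forall s, s \in msupp x -> modified_weight s = 0%N.

Definition result (x : combination) : {poly A} := \sum_(s <- msupp x) x@_s *: 'X^(size s).
End Reduction.

Definition principal_ideal_domain (A : idomainType) : Prop :=
  forall I : A -> Prop, I 0 -> (forall a x y, I x -> I y -> I (a * x + y)) ->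
  exists d, forall x, I x <-> exists b, x = b * d.

(* Main.v *)
Require Import Defs.
From HB Require Import structures.
From mathcomp Require Import all_boot all_order all_algebra.
From mathcomp Require Import zify ring boolp.
From mathcomp Require Import finmap monalg.
From Stdlib Require Import Relations.
Set Implicit Arguments.
Unset Strict Implicit.
Unset Printing Implicit Defensive.
Import GRing.Theory.
Local Open Scope ring_scope.

(* Applying d_Bar to (s1|F|s2) with F = d^-1(f dx), which vanishes at the
   basepoint, gives the reduction step (2), since dF = f dx - (int_w f dx) delta_0.
   A step trades a tensor of modified weight m for at most three of weight below
   m, so the sum of 4^(weight) over the support decreases and the procedure ends
   in a polynomial in delta_0; hence A[t] -> H^0_Bar is onto.
   For injectivity, discrete iterated integrals along the path going N times
   around the loop are linear functionals on Bar which kill coboundaries and send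
   (delta_0|...|delta_0), p factors, to 'C(N, p). If sum_p a_p delta_0^p is a
   coboundary, then sum_p a_p 'C(N, p) = 0 for all N, so every a_p is 0. *)

(** * Cohomology classes of bar cocycles *)

Section Cohomologous.
Variables (A : comNzRingType) (C : augdga A) (k : int).
Implicit Types x y z : bar C.

Lemma cohomologous_refl x : cohomologous k x x.
Proof. by exists 0; rewrite ?rpred0 // linear0 subrr. Qed.

Lemma cohomologous_trans y x z :
  cohomologous k x y -> cohomologous k y z -> cohomologous k x z.
Proof.
move=> [b bk db] [c ck dc]; exists (b + c); first exact: rpredD.
by rewrite linearD /= db dc addrA subrK.
Qed.

Lemma cohomologous_lin a x y x' y' : cohomologous k x x' -> cohomologous k y y' ->
  cohomologous k (a *: x + y) (a *: x' + y').
Proof.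
move=> [b bk db] [c ck dc]; exists (a *: b + c); first by rewrite rpredD ?rpredZ.
by rewrite linearP /= db dc scalerBr addrACA opprD.
Qed.

Lemma cocval_insubd x : x \in cocycle k -> cocval (insubd (0 : cocycles C k) x) = x.
Proof. exact: insubdK. Qed.

Lemma qclass_coboundary (u v : cocycles C k) :
  qclass (coboundary C k) u = qclass (coboundary C k) v
  <-> cohomologous k (cocval u) (cocval v).
Proof.
split=> [/qclassP/asboolP|] [b bk db]; first by exists b; first exact: bk.
by apply/qclassP/asboolP; exists b; first exact: bk.
Qed.

Lemma hclass_eq x y : x \in cocycle k -> y \in cocycle k ->
  hclass k x = hclass k y <-> cohomologous k x y.
Proof.
move=> xk yk.
have := qclass_coboundary (insubd (0 : cocycles C k) x) (insubd (0 : cocycles C k) y).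
move: (cocval_insubd xk) (cocval_insubd yk); rewrite /hclass.
by move: (insubd _ x) (insubd _ y) => u v -> ->.
Qed.

Lemma hclass_lin a x y : x \in cocycle k -> y \in cocycle k ->
  hclass k (a *: x + y) = a *: hclass k x + hclass k y.
Proof.
move=> xk yk; rewrite /hclass -linearP; congr (qclass _ _); apply: val_inj.
have xyk : a *: x + y \in cocycle k := (cocycle_closed C k).2 a x y xk yk.
apply: etrans (cocval_insubd xyk) _; rewrite -[RHS]/(a *: cocval _ + cocval _).
move: (cocval_insubd xk) (cocval_insubd yk).
by move: (insubd _ x) (insubd _ y) => u v -> ->.
Qed.

Lemma hclass_surj (h : Hbar C k) : exists2 x, x \in cocycle k & h = hclass k x.
Proof.
exists (cocval (qrepr h)); first by case: (qrepr h).
by rewrite -[LHS]qreprK /hclass valKd.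
Qed.
End Cohomologous.

Lemma Hbar_map_hclass (A : comNzRingType) (C D : augdga A) (phi : dgmorph C D) k x :
  x \in cocycle k -> Hbar_map phi (hclass k x) = hclass k (bar_map phi x).
Proof.
move=> xk; rewrite /Hbar_map /hclass.
rewrite (qliftE _ (@Hbar_map_rel _ _ _ phi k)) /=.
congr (qclass _ _); apply: val_inj; rewrite /= !insubdK //.
by have := cocycle_map_subproof phi (Cocycle xk).
Qed.

Lemma drop_size_cons T (s1 s2 s3 : seq T) k :
  k = (size s1 + size s2)%N -> drop k (s1 ++ s2 ++ s3) = s3.
Proof. by move=> ->; rewrite catA drop_size_cat // size_cat. Qed.

(** * The bar complex of a graph in degrees -1 and 0 *)

Section LowDegree.
Variables (A : comNzRingType) (X : ptgraph).
Local Notation C := (cochains A X).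
Local Notation form1 := (@Defs.form A X).
Implicit Types (s : seq (bgen C)) (a : seq (coch A X 1)).

(** A graph has no nonzero cochains above degree 1. Hence differentials of 1-forms and products of
    two 1-forms drop out of [bar_d]. *)
Lemma tens_ge2 s1 (x : bgen C) s2 : (1 < deg x)%N -> tens (s1 ++ x :: s2) = 0.
Proof.
case: x => i u i2; suff -> : u = 0 by rewrite tens0.
by apply: val_inj; apply: coch_ge2.
Qed.

Definition vform (F : coch A X 0) (hF : (F : C 0%N) \in augker C 0) : bgen C :=
  Tagged (augideal C) (AugIdeal hF).

Lemma deg1_form (x : bgen C) : deg x = 1%N -> exists b, x = form1 b.
Proof.
case: x => -[|[|i]] u //= _.
by exists (aival u); congr (Tagged _ _); apply: val_inj.
Qed.

Lemma deg0_vform (x : bgen C) : deg x = 0%N -> exists F hF, x = @vform F hF.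
Proof.
case: x => -[|i] //= -[F hF] _.
by exists F, hF.
Qed.

Lemma bgen_d_vform F hF : bgen_d (@vform F hF) = form1 (coch_d F).
Proof. by congr (Tagged _ _); apply: val_inj. Qed.

Lemma bgen_mul_vform F hF b : bgen_mul (@vform F hF) (form1 b) = form1 (coch_mul F b).
Proof. by congr (Tagged _ _); apply: val_inj. Qed.

Lemma bgen_mul_form b F hF : bgen_mul (form1 b) (@vform F hF) = form1 (coch_mul b F).
Proof. by congr (Tagged _ _); apply: val_inj. Qed.

Definition low : pred (bgen C) := fun x => (deg x <= 1)%N.

Lemma tens_notlow s : ~~ all low s -> tens s = 0.
Proof.
rewrite -has_predC => /split_find[x s1 s2 /=]; rewrite /low -ltnNge => x2 _.
by rewrite -cats1 -catA tens_ge2.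
Qed.

Lemma low_deg_le0 s : all low s -> tens_deg s <= 0.
Proof.
elim: s => [|x s IH /andP[x1 /IH]]; first by rewrite /tens_deg big_nil.
rewrite /tens_deg big_cons; move: x1; rewrite /low.
by move: (\sum_(c <- s) _) => u; lia.
Qed.

Lemma low_deg0 s : all low s -> tens_deg s = 0 -> exists a, s = map form1 a.
Proof.
elim: s => [|x s IH /andP[x1 ls]]; first by exists [::].
have := low_deg_le0 ls; rewrite /tens_deg big_cons => s0 xs0.
have [/deg1_form[b ->] s0'] : deg x = 1%N /\ tens_deg s = 0.
  move: x1 s0 xs0; rewrite /low /tens_deg.
  by move: (\sum_(c <- s) _) => u *; split; lia.
by have [a ->] := IH ls s0'; exists (b :: a).
Qed.

(** A slot of degree 0 contributes -1 to the total and a slot of degree 1 contributes 0, so exactly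
    one slot is a 0-cochain. Coboundaries in degree 0 are thus determined by [bar_d_vform]. *)
Lemma low_degN1 s : all low s -> tens_deg s = -1 ->
  exists a1 F hF a2, s = map form1 a1 ++ @vform F hF :: map form1 a2.
Proof.
elim: s => [|x s IH /andP[x1 ls]]; first by rewrite /tens_deg big_nil.
rewrite /tens_deg big_cons => xs1.
move: x1; rewrite /low leq_eqVlt ltnS leqn0 => /orP[/eqP dx|/eqP dx].
  have [b ->] := deg1_form dx; have [|a1 [F [hF [a2 ->]]]] := IH ls.
    by move: xs1; rewrite dx subrr add0r.
  by exists (b :: a1), F, hF, a2.
have [F [hF ->]] := deg0_vform dx; have [|a ->] := low_deg0 ls.
  by move: xs1; rewrite dx /tens_deg; move: (\sum_(c <- s) _) => u; lia.
by exists [::], F, hF, a.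
Qed.

Lemma tens1_in0 a : tens1 a \in bar_in 0.
Proof.
have -> : 0 = tens_deg (map form1 a).
  by rewrite /tens_deg big_map big1.
exact: bar_in_tens.
Qed.

(** A slot of degree at least 2 may balance slots of degree 0 in the total degree, but such a tensor
    is zero; the remaining generators have only 1-forms as slots. *)
Lemma bar_in0E (T : bar C) :
  (T \in bar_in 0) = (T \in submod_span (fun T => exists a, T = tens1 a)).
Proof.
apply/idP/idP => /asboolP; elim=> [|a x y xX _ IH]; rewrite ?rpred0 //.
  case: xX => s s0 ->; rewrite rpredD // rpredZ //.
  have [/low_deg0/(_ s0)[u ->]|/tens_notlow->] := boolP (all low s); last exact: rpred0.
  apply/asboolP; rewrite -[tens _]scale1r -[_ *: _]addr0.
  by right; [exists u | left].
by case: xX => s ->; rewrite rpredD // rpredZ // tens1_in0.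
Qed.

Lemma tensN1_in a1 F hF a2 :
  tens (map form1 a1 ++ @vform F hF :: map form1 a2) \in bar_in (-1).
Proof.
set s := _ ++ _; suff -> : -1 = tens_deg s by exact: bar_in_tens.
by rewrite /tens_deg big_cat big_cons !big_map !big1.
Qed.

Lemma bar_d_vform a1 F hF a2 :
  bar_d (tens (map form1 a1 ++ @vform F hF :: map form1 a2)) =
  - tens1 (a1 ++ coch_d F :: a2) - cup_left a1 F a2 + cup_right a1 F a2.
Proof.
set s := _ ++ _; rewrite bar_d_tens.
have szs : size s = (size a1 + (size a2).+1)%N by rewrite size_cat /= !size_map.
have nth_l i : (i < size a1)%N -> nth (bgen0 C) s i = form1 (nth 0 a1 i).
  by move=> lti; rewrite nth_cat size_map lti (nth_map 0).
have nth_m : nth (bgen0 C) s (size a1) = vform hF.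
  by rewrite nth_cat size_map ltnn subnn.
have nth_r i : (i < size a2)%N -> nth (bgen0 C) s (size a1 + i.+1) = form1 (nth 0 a2 i).
  move=> lti; rewrite nth_cat size_map ltnNge leq_addr /= addKn /=.
  by rewrite (nth_map 0).
(* Each 1-form before F adds 1 to the position and 1 to the degree sum, so the exponent at F is
   even. Passing F adds 1 to the position only. *)
have sgn : bar_sign (size a1) s = 1 /\ bar_sign (size a1).+1 s = -1.
  rewrite /bar_sign map_cat -map_comp.
  have -> : [seq deg (form1 b) | b <- a1] = nseq (size a1) 1%N.
    by elim: a1 {s szs nth_l nth_m nth_r} => //= b a1 ->.
  rewrite /= take_size_cat ?size_nseq // -cat_rcons.
  rewrite take_size_cat ?size_rcons ?size_nseq // -cats1 sumn_cat sumn_nseq mul1n.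
  by rewrite /= !addn0 addSn addnn exprS -signr_odd odd_double mulr1.
have d1 : bar_d1 s = - tens1 (a1 ++ coch_d F :: a2).
  rewrite /bar_d1; congr (- _).
  have lt1 : (size a1 < size s)%N by rewrite szs addnS ltnS leq_addr.
  rewrite (bigD1 (Ordinal lt1)) //= big1 => [|[i lti] /= ne].
    rewrite addr0 sgn.1 scale1r nth_m /tens1 map_cat /=.
    rewrite bgen_d_vform take_size_cat ?size_map //.
    by rewrite (@drop_size_cons _ _ [:: _]) //= size_map addn1.
  rewrite tens_ge2 ?scaler0 //.
  have : i != size a1 by [].
  rewrite neq_ltn => /orP[/nth_l-> //|gti].
  have -> : i = (size a1 + (i - size a1).-1.+1)%N by lia.
  by rewrite nth_r //; have := lti; rewrite szs; lia.
have d2 : bar_d2 s = - (cup_left a1 F a2 - cup_right a1 F a2).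
  rewrite /bar_d2 szs addnS /=; congr (- _).
  (* The products of neighbours split at F: in the first block only the last product involves F, in
     the second only the first one. *)
  rewrite big_split_ord /=; congr (_ + _).
    case/lastP: a1 @s szs nth_l nth_m nth_r sgn d1 => [|a1 b] s szs nth_l nth_m nth_r sgn _.
      by rewrite big_ord0.
    rewrite size_rcons in szs nth_l nth_m nth_r sgn *.
    rewrite big_ord_recr /= big1 => [|[i lti] _ /=]; last first.
      by rewrite !nth_l ?tens_ge2 ?scaler0 // ltnW.
    rewrite add0r sgn.1 scale1r nth_l // nth_m nth_rcons ltnn eqxx.
    have -> : cup_left (rcons a1 b) F a2 = tens1 (a1 ++ coch_mul b F :: a2).
      by case: (a1) => [|c r] //=; rewrite last_rcons belast_rcons.
    rewrite /tens1 map_cat /= /s map_rcons cat_rcons take_size_cat ?size_map //.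
    rewrite bgen_mul_form.
    by rewrite (@drop_size_cons _ _ [:: _; _]) //= size_map addn2.
  case: a2 @s szs nth_l nth_m nth_r sgn {d1} => [|b a2] s szs nth_l nth_m nth_r sgn.
    by rewrite big_ord0 oppr0.
  rewrite big_ord_recl /= big1 => [|[i lti] _ /=]; last first.
    by rewrite /bump /= add1n -addnS !nth_r ?tens_ge2 ?scaler0 //= ltnW.
  rewrite addr0 addn0 sgn.2 scaleN1r; congr (- _).
  rewrite nth_m -addn1 nth_r //= /tens1 map_cat /=.
  rewrite bgen_mul_vform take_size_cat ?size_map //.
  by rewrite (@drop_size_cons _ _ [:: _; _]) //= size_map addn1 addn2.
by rewrite d1 d2 opprB addrA addrAC.
Qed.
End LowDegree.

(** * Discrete iterated integrals *)

Section IteratedIntegral.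
Variables (A : comNzRingType) (S : Type) (n : nat) (w : 'I_n -> S + S).
Local Notation X := (loop w).
Local Notation C := (cochains A X).
Local Notation form1 := (@Defs.form A X).
Implicit Types (x : bgen C) (r s : seq (bgen C)) (a : coch A X 1).

(** The value 0 outside degree 1 extends the iterated integral to all tensors while keeping it
    linear in every slot. *)
Definition coch1_val i : coch A X i -> 'I_n.+1 -> A :=
  match i return coch A X i -> 'I_n.+1 -> A with
  | 1 => fun (a : {ffun 'I_n.+1 -> A^o}) e => a e
  | _ => fun _ _ => 0
  end.

Definition bgen_val x (e : 'I_n.+1) : A := coch1_val (aival (tagged x)) e.

Lemma bgen_val_linear i b (u v : augideal C i) e :
  bgen_val (Tagged (augideal C) (b *: u + v)) e =
  b * bgen_val (Tagged (augideal C) u) e + bgen_val (Tagged (augideal C) v) e.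
Proof.
case: i u v => [|[|i]] u v; rewrite /bgen_val /= ?mulr0 ?addr0 //.
by rewrite !ffunE.
Qed.

Definition edge_sign (e : 'I_n.+1) : A := if positive w e then 1 else -1.

(* The path winds around the loop, its [j]-th step running along the edge
   [j mod n+1], forwards or backwards. *)
Definition step_src (j : nat) : nat := if positive w (inZp j) then j else j.+1.

(* The iterated integral over the first [k] steps of the path, for the tensor
   whose entries are listed backwards in [r]. A step along an edge traversed
   backwards contributes the inverse of 1 + x, whence the recursive call at the
   source of the edge rather than at the start of the step. *)
Fixpoint walk (r : seq (bgen C)) (k : nat) : A :=
  if r is x :: r' then
    \sum_(j < k) edge_sign (inZp j) * bgen_val x (inZp j) * walk r' (step_src j)
  else 1.

Lemma walkS x r k : walk (x :: r) k.+1 =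
  walk (x :: r) k + edge_sign (inZp k) * bgen_val x (inZp k) * walk r (step_src k).
Proof. by rewrite /= big_ord_recr. Qed.

Lemma walk_slot r2 r1 i b (u v : augideal C i) k :
  walk (r2 ++ Tagged (augideal C) (b *: u + v) :: r1) k =
  b * walk (r2 ++ Tagged (augideal C) u :: r1) k
  + walk (r2 ++ Tagged (augideal C) v :: r1) k.
Proof.
elim: r2 k => [|x r2 IH] k /=; rewrite mulr_sumr -big_split /=; apply: eq_bigr => j _.
  by rewrite bgen_val_linear mulrDr mulrCA mulrDl !mulrA.
by rewrite IH mulrDr mulrCA.
Qed.

Definition vert_val (F : coch A X 0) (v : 'I_n.+1) : A := (F : {ffun 'I_n.+1 -> A^o}) v.

Lemma ordS_inZp j : ordS (inZp j : 'I_n.+1) = inZp j.+1.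
Proof. by apply: val_inj; rewrite /= -addn1 modnDml addn1. Qed.

Lemma bgen_val_d (F : coch A X 0) j : bgen_val (form1 (coch_d F)) (inZp j) =
  edge_sign (inZp j) * (vert_val F (inZp j.+1) - vert_val F (inZp j)).
Proof. by rewrite -ordS_inZp; apply: loop_dE. Qed.

Definition step_tgt (j : nat) : nat := if positive w (inZp j) then j.+1 else j.

Lemma bgen_val_mulr a (F : coch A X 0) j :
  bgen_val (form1 (coch_mul a F)) (inZp j) =
  vert_val F (inZp (step_tgt j)) * bgen_val (form1 a) (inZp j).
Proof.
rewrite /bgen_val /= ffunE /step_tgt /=.
by case: positive; rewrite // ordS_inZp.
Qed.

Lemma bgen_val_mull a (F : coch A X 0) j :
  bgen_val (form1 (coch_mul F a)) (inZp j) =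
  vert_val F (inZp (step_src j)) * bgen_val (form1 a) (inZp j).
Proof.
rewrite /bgen_val /= ffunE /step_src /=.
by case: positive; rewrite // ordS_inZp.
Qed.

(* Stokes along a path from the basepoint to an arbitrary vertex; the term
   F(end) vanishes once the path closes up. *)
Lemma walk_d (F : coch A X 0) (r : seq (coch A X 1)) k : vert_val F (inZp 0) = 0 ->
  walk (form1 (coch_d F) :: map form1 r) k =
  vert_val F (inZp k) * walk (map form1 r) k
  - (if r is b :: r' then walk (form1 (coch_mul b F) :: map form1 r') k else 0).
Proof.
move=> F0; elim: k => [|k IH].
  by rewrite F0 mul0r; case: r => [|b r]; rewrite /= !big_ord0 subr0.
(* This is a discrete Leibniz rule: with the inner integral taken at the source of the edge, the
   correction carries F at the target, as [coch_mul b F] does. *)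
rewrite walkS IH {IH} bgen_val_d {1}/step_src.
case: r => [|b r]; case E: (positive w (inZp k)); rewrite ?map_cons ?walkS ?bgen_val_mulr
  /edge_sign /step_src /step_tgt E /=; ring.
Qed.

(** The inner walk below b ends at the source of the edge on which b is evaluated. The end term of
    [walk_d] is therefore F at that source, which is the factor in the cup product of F with b. The
    outer entries [r2] only sum the identity. *)
Lemma walk_cat_d (F : coch A X 0) (r1 r2 : seq (coch A X 1)) b k :
  vert_val F (inZp 0) = 0 ->
  walk (map form1 (rcons r2 b) ++ form1 (coch_d F) :: map form1 r1) k =
  walk (map form1 r2 ++ form1 (coch_mul F b) :: map form1 r1) k
  - (if r1 is a :: r1' then
       walk (map form1 (rcons r2 b) ++ form1 (coch_mul a F) :: map form1 r1') k else 0).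
Proof.
move=> F0; elim: r2 k => [|c r2 IH] k.
  rewrite [map _ _]/= !cat0s cat1s.
  rewrite -[LHS]/(\sum_(j < k) _ * walk (form1 (coch_d F) :: _) _).
  under eq_bigr => j _ do rewrite (walk_d _ _ F0).
  rewrite -[X in X - _]/(\sum_(j < k) _ * bgen_val _ _ * walk _ _).
  under [X in X - _]eq_bigr => j _ do rewrite bgen_val_mull.
  case: r1 => [|a r1].
    by rewrite subr0; apply: eq_bigr => j _; rewrite subr0; ring.
  rewrite -sumrB; apply: eq_bigr => j _ /=; ring.
rewrite rcons_cons !map_cons !cat_cons.
rewrite -[LHS]/(\sum_(j < k) _ * walk (_ ++ form1 (coch_d F) :: _) _).
under eq_bigr => j _ do rewrite IH.
case: r1 {IH} => [|a r1]; first by rewrite subr0; apply: eq_bigr => j _; rewrite subr0.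
by rewrite -sumrB; apply: eq_bigr => j _; rewrite mulrBr.
Qed.

Definition loop_integral N (s : seq (bgen C)) : A^o := walk (rev s) (N * n.+1).

Lemma loop_integral_multilinear N : multilinear (loop_integral N).
Proof.
move=> s1 s2 i b u v; rewrite /loop_integral !rev_cat !rev_cons !cat_rcons.
exact: walk_slot.
Qed.

Definition bar_integral N : bar C -> A^o := barlift (loop_integral N).

HB.instance Definition _ N := GRing.isLinear.Build A (bar C) A^o *:%R (bar_integral N)
  (barlift_linear (loop_integral_multilinear N)).

Lemma bar_integral_tens1 N (s : seq (coch A X 1)) :
  bar_integral N (tens1 s) = walk (map form1 (rev s)) (N * n.+1).
Proof.
rewrite /bar_integral barlift_tens; last exact: loop_integral_multilinear.
by rewrite /loop_integral map_rev.
Qed.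

(** If [s2] is empty, the end term of Stokes is F at the basepoint, where the path closes up, and so
    it vanishes. Otherwise it is absorbed into the cup product with the next entry. *)
Lemma bar_integral_d N (s1 s2 : seq (coch A X 1)) (F : coch A X 0) : vert_val F ord0 = 0 ->
  bar_integral N (tens1 (s1 ++ coch_d F :: s2)) =
  bar_integral N (cup_right s1 F s2) - bar_integral N (cup_left s1 F s2).
Proof.
move=> F0.
have E0 : inZp 0 = ord0 :> 'I_n.+1 by apply: val_inj; rewrite /= mod0n.
have EN : inZp (N * n.+1) = ord0 :> 'I_n.+1 by apply: val_inj; rewrite /= modnMl.
have -> : cup_left s1 F s2 = if rev s1 is a :: r1 then
    tens1 (rev r1 ++ coch_mul a F :: s2) else 0.
  case/lastP: s1 => // s1 b; rewrite rev_rcons revK.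
  by case: s1 => [|c s1] //=; rewrite last_rcons belast_rcons.
rewrite -E0 in F0.
case: s2 => [|b s2]; rewrite bar_integral_tens1 rev_cat rev_cons.
  rewrite (walk_d (rev s1) _ F0) EN -E0 F0 mul0r linear0; congr (_ - _).
  by case: (rev s1) => [|a r]; rewrite ?linear0 // bar_integral_tens1 rev_cat revK.
rewrite rev_cons map_cat map_rcons cat_rcons.
rewrite walk_cat_d // bar_integral_tens1; congr (_ - _).
  by rewrite rev_cat rev_cons map_cat map_rcons cat_rcons.
case: (rev s1) => [|a r]; first by rewrite linear0.
by rewrite bar_integral_tens1 rev_cat !rev_cons revK !map_cat !map_rcons !cat_rcons.
Qed.

Lemma bar_integral_coboundary N (x : bar C) :
  x \in bar_in (-1) -> bar_integral N (bar_d x) = 0.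
Proof.
move=> /asboolP; elim=> [|a y z [s sN1 ->] _ IH]; first by rewrite !linear0.
rewrite !linearP /= IH addr0.
have [ls|/tens_notlow->] := boolP (all (@low A X) s); last by rewrite !linear0.
have [a1 [F [hF [a2 ->]]]] := low_degN1 ls sN1.
rewrite bar_d_vform linearD linearB linearN /= bar_integral_d; last exact/eqP.
by rewrite opprB addrAC subrK subrr scaler0.
Qed.

(** Every turn crosses edge 0 once, and the crossings used by the p factors are strictly ordered, so
    the integral counts choices of p turns out of N. *)
Lemma bar_integral_delta0 N p :
  bar_integral N (tens1 (nseq p (delta0 w A))) = 'C(N, p)%:R.
Proof.
rewrite bar_integral_tens1.
have -> : rev (nseq p (delta0 w A)) = nseq p (delta0 w A).
  by elim: p => //= p IH; rewrite rev_cons IH; elim: p {IH} => //= p ->.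
(* (k + n) %/ n.+1 counts the visits of edge 0 during the first k steps *)
suff H k : walk (map form1 (nseq p (delta0 w A))) k = 'C((k + n) %/ n.+1, p)%:R.
  by rewrite H divnMDl // divn_small // addn0.
elim: p k => [|p IH] k; first by rewrite bin0.
elim: k => [|k IHk]; first by rewrite add0n divn_small //= big_ord0.
rewrite [map _ _]/= walkS IHk IH /bgen_val /= ffunE.
have -> : (inZp k == ord0 :> 'I_n.+1) = (n.+1 %| k)%N by rewrite -val_eqE.
rewrite addSn divnS // -addnS.
have -> : (n.+1 %| k + n.+1)%N = (n.+1 %| k)%N by rewrite dvdn_addl.
have [/dvdnP[q ->]|] := boolP (n.+1 %| k)%N; last first.
  by rewrite mulr0 mul0r addr0 add0n.
have E0 : inZp (q * n.+1) = ord0 :> 'I_n.+1 by apply: val_inj; rewrite /= modnMl.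
(* Edge 0 is positive, so the inner walk stops just before the current crossing; what remains is
   Pascal's rule. *)
rewrite /edge_sign /step_src E0 /positive unlift_none !mul1r add1n binS natrD addrC.
by [].
Qed.

(** * Independence of the powers of delta_0 in cohomology *)

Lemma delta0_poly_linear : linear (@delta0_poly S n w A).
Proof.
(* The range of summation depends on the size of the polynomial, so all sums are padded to a common
   length first. *)
pose F (p : {poly A}) k : bar C :=
  \sum_(i < k) p`_i *: tens1 (nseq i (delta0 w A)).
have FE (p : {poly A}) k : (size p <= k)%N -> delta0_poly w p = F p k.
  move=> le_pk; rewrite /delta0_poly.
  rewrite (big_ord_widen _ (fun i => p`_i *: tens1 (nseq i (delta0 w A))) le_pk).
  rewrite big_mkcond; apply: eq_bigr => i _; case: ltnP => // /(nth_default 0) ->.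
  by rewrite scale0r.
move=> a p q; pose k := maxn (size (a *: p + q)) (maxn (size p) (size q)).
rewrite !(FE _ k) ?leq_maxl // /k ?leq_max ?leqnn ?orbT //.
rewrite /F scaler_sumr -big_split /=; apply: eq_bigr => i _.
by rewrite coefD coefZ scalerDl scalerA.
Qed.
HB.instance Definition _ := GRing.isLinear.Build A {poly A} (bar C) *:%R
  (@delta0_poly S n w A) delta0_poly_linear.

Lemma delta0_poly_in0 (p : {poly A}) : delta0_poly w p \in bar_in 0.
Proof. by apply: rpred_sum => i _; rewrite rpredZ // tens1_in0. Qed.

Lemma delta0_poly_inj (p : {poly A}) : cohomologous 0 (delta0_poly w p) 0 -> p = 0.
Proof.
move=> [b bN1 db]; apply/polyP => N; rewrite coef0.
have H k : \sum_(i < size p) p`_i * 'C(k, i)%:R = 0.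
  have := bar_integral_coboundary k bN1; rewrite db subr0 linear_sum.
  under eq_bigr => i _ do rewrite linearZ /= bar_integral_delta0.
  by [].
have [lt_p|/(nth_default 0)->//] := ltnP N (size p).
(* The system is unitriangular: 'C(N, i) is 0 for i > N and 1 for i = N. It is solved without any
   division in A. *)
elim/ltn_ind: N lt_p => N IH lt_p.
have := H N; rewrite (bigD1 (Ordinal lt_p)) //= binn mulr1 big1 ?addr0 // => i ne.
case: (ltngtP i N) => [lt_i|gt_i|eq_i].
- by rewrite IH ?mul0r // ltnW // (leq_ltn_trans _ lt_p).
- by rewrite bin_small // mulr0.
by case/eqP: ne; apply: val_inj.
Qed.

(** The collapsing map pulls the cochain tau of the circle back to delta_0. *)
Lemma loop_classE (p : {poly A}) : @loop_class S n w A p = hclass 0 (delta0_poly w p).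
Proof.
rewrite /loop_class /circle_class Hbar_map_hclass; last first.
  by apply: bar0_cocycle; apply: rpred_sum => i _; rewrite rpredZ // tens1_in0.
congr (hclass 0 _); rewrite linear_sum; apply: eq_bigr => i _.
rewrite linearZ /= /tens1 bar_map_tens -map_comp; congr (_ *: tens _).
rewrite !map_nseq; congr nseq.
congr (Tagged _ _); apply: val_inj; apply/ffunP => e; rewrite !ffunE /=.
by case: (e == ord0); rewrite ?ffunE.
Qed.
End IteratedIntegral.

(** * Weight reduction *)

(** This bounds a sum over the support of a combination by one over a list of summands in which
    repetitions may occur. *)
Lemma leq_sum_uniq_sub (T : eqType) (g : T -> nat) (l m : seq T) :
  uniq l -> {subset l <= m} -> (\sum_(x <- l) g x <= \sum_(x <- m) g x)%N.
Proof.
elim: l m => [|x l IH] m /=; first by rewrite big_nil.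
move=> /andP[xl ul] sub; have xm : x \in m by apply: sub; rewrite mem_head.
rewrite big_cons (perm_big _ (perm_to_rem xm)) big_cons leq_add2l; apply: IH => // y yl.
have yx : y != x by apply: contraNneq xl => <-.
have : y \in x :: rem x m by rewrite -(perm_mem (perm_to_rem xm)) sub // in_cons yl orbT.
by rewrite in_cons (negPf yx).
Qed.

Section Weight.
Variables (A : comNzRingType) (n : nat).
Implicit Types (e : entry A n) (s : seq (entry A n)).

Lemma modified_weightE s : modified_weight s = count (predC (@is_t A n)) s.
Proof. by rewrite /modified_weight -(count_predC (@is_t A n) s) addKn. Qed.

Lemma modified_weight_cat s1 s2 :
  modified_weight (s1 ++ s2) = (modified_weight s1 + modified_weight s2)%N.
Proof. by rewrite !modified_weightE count_cat. Qed.

Lemma modified_weight_cons e s :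
  modified_weight (e :: s) = (~~ is_t e + modified_weight s)%N.
Proof. by rewrite !modified_weightE. Qed.

Lemma modified_weight0 s : modified_weight s = 0%N -> s = nseq (size s) EntT.
Proof.
elim: s => //= -[|f] s IH; rewrite modified_weight_cons //= => /IH {1}->.
by [].
Qed.

Lemma modified_weight_gt0 s : modified_weight s != 0%N ->
  exists s1 f s2, s = s1 ++ EntDx f :: s2.
Proof.
elim: s => //= -[|f] s IH; last by exists [::], f, s.
by rewrite modified_weight_cons => /IH[s1 [f [s2 ->]]]; exists (EntT :: s1), f, s2.
Qed.
End Weight.

Section Procedure.
Variables (A : comNzRingType) (S : Type) (n : nat) (w : 'I_n -> S + S).
Local Notation X := (loop w).
Local Notation C := (cochains A X).
Local Notation entry_form := (@entry_form A S n w).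
Implicit Types (e : entry A n) (s : seq (entry A n)) (f g : {ffun 'I_n -> A}).
Implicit Types (a : coch A X 1) (F : coch A X 0) (x y : {malg A[seq (entry A n)]}).

(** * The cobounding of f dx and its cup products *)

Lemma int_dx_recl f i : (0 < i)%N -> int_dx f 1 i - int_word f = - int_dx f i n.+1.
Proof.
move=> i0; rewrite /int_dx /int_word (gtn_eqF i0) /=.
apply/eqP; rewrite subr_eq addrC -subr_eq opprK; apply/eqP.
rewrite [RHS](bigID (fun k : 'I_n => (k.+1 < i)%N)) /=.
by congr (_ + _); apply: eq_bigl => k //; rewrite -leqNgt ltnS ltn_ord andbT.
Qed.

(** The convention that integrals from 0 vanish makes one formula serve all vertices, including the
    basepoint where the last segment ends. *)
Lemma coboundE f (j : 'I_n.+1) : vert_val (cobound w f) j = - int_dx f j n.+1.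
Proof.
rewrite /vert_val ffunE; case: eqP => [->|/eqP j0]; first by rewrite /int_dx oppr0.
by rewrite int_dx_recl // lt0n.
Qed.

Lemma cobound0 f : vert_val (cobound w f) ord0 = 0.
Proof. by rewrite coboundE /int_dx oppr0. Qed.

Lemma cobound1 f : vert_val (cobound w f) (ordS ord0) = - int_word f.
Proof.
rewrite coboundE; congr (- _); rewrite /int_dx /int_word /=.
(* For the empty word, edge 0 returns to the basepoint and both sides are 0. *)
case: n f => [|m] f; first by rewrite modn1 /= big_ord0.
rewrite modn_small //=; apply: eq_bigl => k; by rewrite ltnS ltn_ord.
Qed.

Lemma d_cobound f : coch_d (cobound w f) = fdx w f - int_word f *: delta0 w A.
Proof.
apply/ffunP => i; rewrite loop_dE -/(vert_val _ _) -/(vert_val _ i) !ffunE.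
case: (unliftP ord0 i) => [k ->|->]; last first.
  by rewrite cobound0 cobound1 /positive unlift_none eqxx mul1r subr0 sub0r [_ *: _]mulr1.
rewrite [_ == ord0]eq_sym (negPf (neq_lift _ _)) scaler0 subr0.
suff -> : vert_val (cobound w f) (ordS (lift ord0 k))
    - vert_val (cobound w f) (lift ord0 k) = f k.
  by case: positive; rewrite ?mul1r ?mulN1r.
rewrite !coboundE opprK addrC /int_dx /= /bump /= add1n.
(* The last segment ends at the basepoint, where the index wraps around to 0 and the cobounding
   vanishes. *)
have [e|ne] := eqVneq k.+1 n.
  have -> : (k.+2 %% n.+1)%N = 0%N by rewrite e modnn.
  rewrite /= subr0 (big_pred1 k) // => j.
  case: k e => k ltk /= e; case: j => j ltj; rewrite -val_eqE /=; lia.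
have lt : (k.+2 < n.+1)%N by rewrite ltnS ltn_neqAle ne ltn_ord.
rewrite modn_small //= (bigD1 k) ?leqnn /= ?ltnS ?ltn_ord //.
rewrite [X in _ + X - _](eq_bigl (fun j : 'I_n => (k.+1 < j.+1 < n.+1)%N)) ?addrK // => j.
by rewrite -val_eqE /=; lia.
Qed.

Lemma delta0_cobound f :
  coch_mul (delta0 w A) (cobound w f) = - int_word f *: delta0 w A.
Proof.
apply/ffunP => i; rewrite ffunE /= -/(vert_val _ _) !ffunE.
case: eqP => [->|_]; last by rewrite mulr0 scaler0.
by rewrite /positive unlift_none cobound1.
Qed.

Lemma cobound_delta0 f : coch_mul (cobound w f) (delta0 w A) = 0.
Proof.
apply/ffunP => i; rewrite ffunE /= -/(vert_val _ _) !ffunE.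
case: eqP => [->|_]; last by rewrite mulr0.
by rewrite /positive unlift_none cobound0 mul0r.
Qed.

Lemma fdx_cobound f g : coch_mul (fdx w g) (cobound w f)
  = fdx w [ffun k => - int_from_tgt w f k * g k].
Proof.
apply/ffunP => i; rewrite ffunE /= -/(vert_val _ _) coboundE !ffunE.
case: (unliftP ord0 i) => [k ->|->]; last by rewrite mulr0.
by rewrite ffunE /int_from_tgt /=; case: positive; rewrite ?mulrN.
Qed.

Lemma cobound_fdx f g : coch_mul (cobound w f) (fdx w g)
  = fdx w [ffun k => - int_from_src w f k * g k].
Proof.
apply/ffunP => i; rewrite ffunE /= -/(vert_val _ _) coboundE !ffunE.
case: (unliftP ord0 i) => [k ->|->]; last by rewrite mulr0.
by rewrite ffunE /int_from_src /=; case: positive; rewrite ?mulrN.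
Qed.

(** * The reduction step and its symbolic form *)

Lemma tens1_slot (s1 s2 : seq (coch A X 1)) b (u v : coch A X 1) :
  tens1 (s1 ++ (b *: u + v) :: s2) = b *: tens1 (s1 ++ u :: s2) + tens1 (s1 ++ v :: s2).
Proof.
rewrite /tens1 !map_cat !map_cons -tens_multilinear.
by congr (tens (_ ++ Tagged _ _ :: _)); apply: val_inj.
Qed.

Lemma tens1_0 (s1 s2 : seq (coch A X 1)) : tens1 (s1 ++ 0 :: s2) = 0.
Proof.
have := tens1_slot s1 s2 (-1) 0 0.
by rewrite scaler0 addr0 scaleN1r addNr.
Qed.

Lemma tens1Z (s1 s2 : seq (coch A X 1)) b (u : coch A X 1) :
  tens1 (s1 ++ (b *: u) :: s2) = b *: tens1 (s1 ++ u :: s2).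
Proof. by have := tens1_slot s1 s2 b u 0; rewrite tens1_0 !addr0. Qed.

Definition reduction_step (s1 : seq (coch A X 1)) f (s2 : seq (coch A X 1)) : bar C :=
  int_word f *: tens1 (s1 ++ delta0 w A :: s2)
  - cup_left s1 (cobound w f) s2 + cup_right s1 (cobound w f) s2.

Lemma reduction_step_cohomologous (s1 s2 : seq (coch A X 1)) f :
  cohomologous 0 (tens1 (s1 ++ fdx w f :: s2)) (reduction_step s1 f s2).
Proof.
have hF : (cobound w f : C 0%N) \in augker C 0.
  by rewrite unfold_in /augker; apply/eqP; apply: cobound0.
(* The sign cancels the minus in front of the dF term of [bar_d_vform]. *)
exists (- tens (map (@Defs.form A X) s1 ++ vform hF :: map (@Defs.form A X) s2)).
  rewrite sub0r -scaleN1r rpredZ //; exact: tensN1_in.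
rewrite linearN /= bar_d_vform d_cobound [fdx w f - _]addrC -scaleNr tens1_slot /reduction_step.
rewrite scaleNr; move: (tens1 _) (_ *: _) (cup_left _ _ _) (cup_right _ _ _) => t d l r.
by rewrite !opprD !opprK [- d + t]addrC -!addrA.
Qed.

Lemma bar_of_linear : linear (@bar_of A S n w).
Proof. exact: freelin_linear. Qed.
HB.instance Definition _ := GRing.isLinear.Build A _ (bar C) *:%R (@bar_of A S n w)
  bar_of_linear.

Lemma bar_ofU s : bar_of w << s >> = tens1 (map entry_form s).
Proof. exact: freelinU. Qed.

Lemma entry_cup_leftE e f :
  coch_mul (entry_form e) (cobound w f)
  = (entry_cup_left w e f).1 *: entry_form (entry_cup_left w e f).2.
Proof.
case: e => [|g]; first exact: delta0_cobound.
by apply: etrans (fdx_cobound _ _) _; rewrite scale1r.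
Qed.

Lemma entry_cup_rightE e f :
  coch_mul (cobound w f) (entry_form e)
  = (entry_cup_right w f e).1 *: entry_form (entry_cup_right w f e).2.
Proof.
case: e => [|g]; first by rewrite scale0r; apply: cobound_delta0.
by apply: etrans (cobound_fdx _ _) _; rewrite scale1r.
Qed.

#[local] Arguments coch_mul : simpl never.

Lemma bar_of_expansion s1 f s2 :
  bar_of w (expansion w s1 f s2) = reduction_step (map entry_form s1) f (map entry_form s2).
Proof.
rewrite /expansion linear_sum /summands big_cons big_cat /= linearZ /= bar_ofU map_cat /=.
rewrite /reduction_step -addrA; congr (_ + (_ + _)).
  case: s1 => [|a s1] /=; first by rewrite big_nil oppr0.
  rewrite big_seq1 linearZ /= bar_ofU map_cat /= last_map belast_map.
  by rewrite entry_cup_leftE tens1Z scaleNr.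
case: s2 => [|b s2] /=; first by rewrite big_nil.
by rewrite big_seq1 linearZ /= bar_ofU map_cat /= entry_cup_rightE tens1Z.
Qed.

(** The first summand turns f dx into t. In the others f dx disappears, and its neighbour stays t or
    stays of the form g dx. *)
Lemma summands_weight s1 f s2 c : c \in summands w s1 f s2 ->
  (modified_weight c.2 < modified_weight (s1 ++ EntDx f :: s2))%N.
Proof.
rewrite modified_weight_cat modified_weight_cons /= add1n addnS ltnS.
rewrite /summands in_cons mem_cat => /or3P[/eqP->/=||].
- by rewrite modified_weight_cat modified_weight_cons.
- case: s1 => // a s1; rewrite inE => /eqP -> /=.
  have -> : modified_weight (a :: s1) =
      (modified_weight (belast a s1) + ~~ is_t (last a s1))%N.
    by rewrite lastI -cats1 modified_weight_cat modified_weight_cons addn0.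
  rewrite modified_weight_cat modified_weight_cons addnA.
  by case: (last a s1).
case: s2 => // b s2; rewrite inE => /eqP -> /=.
rewrite modified_weight_cat !modified_weight_cons.
by case: b.
Qed.

Lemma size_summands s1 f s2 : (size (summands w s1 f s2) <= 3)%N.
Proof. by case: s1 => [|? ?]; case: s2. Qed.

Lemma expansion_supp s1 f s2 s :
  s \in msupp (expansion w s1 f s2) -> s \in map snd (summands w s1 f s2).
Proof.
rewrite -mcoeff_neq0 /expansion raddf_sum; apply: contraR => sN.
rewrite big_seq big1 // => c cS /=.
rewrite mcoeffZ mcoeffU; case: eqP => [e|_]; last by rewrite mulr0n mulr0.
by case/negP: sN; rewrite -e map_f.
Qed.

(** * Termination and correctness of the procedure *)

Definition total_weight x : nat := \sum_(s <- msupp x) 4 ^ modified_weight s.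

Lemma reduces_weight x y : reduces w x y -> (total_weight y < total_weight x)%N.
Proof.
move=> [s1 [f [s2]]]; set s := s1 ++ _ => -[sx ->].
set E := expansion w s1 f s2; set y' := _ + _.
(* The coefficient of s itself cancels. Collecting like terms can only shrink the support further,
   so an inclusion suffices. *)
have sub : {subset msupp y' <= rem s (msupp x) ++ map snd (summands w s1 f s2)}.
  move=> t; rewrite mem_cat -mcoeff_neq0 => yt.
  have [/expansion_supp->|tE] := boolP (t \in msupp E); first by rewrite orbT.
  move: yt; rewrite /y' mcoeffD mcoeffB !mcoeffZ (mcoeff_outdom tE) mulr0 addr0.
  rewrite mcoeffU mem_rem_uniq ?fset_uniq // inE.
  have [->|ne] := eqVneq s t; first by rewrite mulr1 subrr eqxx.
  by rewrite mulr0n mulr0 subr0 mcoeff_neq0 => ->.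
move: sub (@size_summands s1 f s2) (fun c => @summands_weight s1 f s2 c).
move: (summands w s1 f s2) => sm sub size_sm weight_sm.
rewrite /total_weight (leq_ltn_trans (leq_sum_uniq_sub _ (fset_uniq _) sub)) //.
rewrite (perm_big _ (perm_to_rem sx)) big_cons big_cat /= addnC ltn_add2r big_map.
have w0 : (0 < modified_weight s)%N.
  by rewrite modified_weight_cat modified_weight_cons addnCA.
(* At most 3 new tensors appear, each of weight below that of s; the base 4 is chosen to exceed
   3. *)
rewrite -(prednK w0) expnS (@leq_ltn_trans (3 * 4 ^ (modified_weight s).-1)) //; last first.
  by rewrite ltn_mul2r expn_gt0.
apply: (@leq_trans (\sum_(c <- sm) 4 ^ (modified_weight s).-1)).
  rewrite big_seq [leqRHS]big_seq; apply: leq_sum => c cS.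
  by rewrite leq_exp2l // -ltnS (prednK w0) weight_sm.
rewrite big_const_seq count_predT iter_addn_0 mulnC leq_mul2r.
by rewrite size_sm orbT.
Qed.

Lemma reduces_wf : well_founded (fun y x => reduces w x y).
Proof.
move=> x; have [m] := ubnP (total_weight x).
elim: m x => [|m IH] x; first by rewrite ltn0.
rewrite ltnS => le_x; constructor=> y /reduces_weight lt_y; apply: IH.
exact: leq_trans lt_y le_x.
Qed.

Lemma reduces_progress x : ~ halted x -> exists y, reduces w x y.
Proof.
move=> nh; have [s sx /eqP/modified_weight_gt0[s1 [f [s2 es]]]] :
    exists2 s, s \in msupp x & modified_weight s <> 0%N.
  by apply: contra_notP nh => nex s sx; apply: contra_notP nex => ?; exists s.
by rewrite {}es in sx; eexists; exists s1, f, s2.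
Qed.

Lemma reduces_cohomologous x y :
  reduces w x y -> cohomologous 0 (bar_of w x) (bar_of w y).
Proof.
move=> [s1 [f [s2]]]; set s := s1 ++ _ => -[_ ->].
set r := x - _; have -> : bar_of w x = x@_s *: bar_of w << s >> + bar_of w r.
  by rewrite -bar_of_linear addrC subrK.
rewrite [r + _]addrC bar_of_linear bar_of_expansion bar_ofU.
apply: cohomologous_lin; last exact: cohomologous_refl.
by rewrite /s map_cat; apply: reduction_step_cohomologous.
Qed.

Lemma reduction_cohomologous x y :
  clos_refl_trans _ (reduces w) x y -> cohomologous 0 (bar_of w x) (bar_of w y).
Proof.
elim=> [u v /reduces_cohomologous //|u|u v t _ uv _ vt].
  exact: cohomologous_refl.
exact: cohomologous_trans uv vt.
Qed.

Lemma reduction_halts x : exists2 y, clos_refl_trans _ (reduces w) x y & halted y.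
Proof.
elim/(well_founded_ind reduces_wf): x => x IH.
have [hx|/reduces_progress[y xy]] := pselect (halted x).
  by exists x => //; apply: rt_refl.
have [z yz hz] := IH y xy; exists z => //.
by apply: rt_trans yz; apply: rt_step.
Qed.

Lemma delta0_polyXn k : delta0_poly w ('X^k : {poly A}) = tens1 (nseq k (delta0 w A)).
Proof.
rewrite /delta0_poly size_polyXn big_ord_recr /= coefXn eqxx scale1r big1 ?add0r //.
by move=> i _; rewrite coefXn ltn_eqF // scale0r.
Qed.

Lemma bar_of_halted x : halted x -> bar_of w x = delta0_poly w (result x).
Proof.
move=> hx; rewrite /result linear_sum /bar_of /freelin big_seq [RHS]big_seq.
apply: eq_bigr => s sx; rewrite linearZ /= delta0_polyXn; congr (_ *: tens1 _).
by rewrite {1}(modified_weight0 (hx s sx)) map_nseq.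
Qed.

Lemma coch1_decomp a : exists f, a = (a : {ffun 'I_n.+1 -> A^o}) ord0 *: delta0 w A + fdx w f.
Proof.
(* The sign undoes the one that [fdx] puts on segments whose letter is in S^-1. *)
exists [ffun k => if positive w (lift ord0 k) then (a : {ffun 'I_n.+1 -> A^o}) (lift ord0 k)
                  else - (a : {ffun 'I_n.+1 -> A^o}) (lift ord0 k)].
apply/ffunP => i; rewrite !ffunE; case: (unliftP ord0 i) => [k ->|->]; last first.
  by rewrite eqxx addr0 [_ *: _]mulr1.
rewrite [_ == ord0]eq_sym (negPf (neq_lift _ _)) scaler0 add0r ffunE.
by case: positive; rewrite ?opprK.
Qed.

Lemma bar_of_surj (T : bar C) : T \in bar_in 0 -> exists x, T = bar_of w x.
Proof.
(* The slots are expanded from left to right, and [e] accumulates those already written as t or f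
   dx. *)
have tens1_of (s : seq (coch A X 1)) (e : seq (entry A n)) :
    exists x, tens1 (map entry_form e ++ s) = bar_of w x.
  elim: s e => [|a s IH] e; first by exists << e >>; rewrite bar_ofU cats0.
  have [f ->] := coch1_decomp a; rewrite tens1_slot.
  have [x ex] := IH (rcons e EntT); have [y ey] := IH (rcons e (EntDx f)).
  move: ex ey; rewrite !map_rcons !cat_rcons => -> ->.
  by eexists; rewrite -bar_of_linear.
rewrite bar_in0E => /asboolP; elim=> [|b y z [s ->] _ [x ->]].
  by exists 0; rewrite linear0.
have [u eu] := tens1_of s [::]; exists (b *: u + x).
by rewrite bar_of_linear -eu.
Qed.

Lemma bar_of_in0 x : bar_of w x \in bar_in 0.
Proof. by apply: rpred_sum => s _; rewrite rpredZ // tens1_in0. Qed.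

Lemma delta0_poly_surj (T : bar C) : T \in bar_in 0 ->
  exists p : {poly A}, cohomologous 0 T (delta0_poly w p).
Proof.
move=> /bar_of_surj[x ->]; have [y xy hy] := reduction_halts x.
by exists (result y); rewrite -bar_of_halted //; apply: reduction_cohomologous.
Qed.

(** * The isomorphism with A[t] and its inverse *)

Lemma loop_class_linear : linear (@loop_class S n w A).
Proof.
move=> b p q; rewrite !loop_classE linearP.
by apply: hclass_lin; apply: bar0_cocycle; apply: delta0_poly_in0.
Qed.

Lemma loop_class_inj : injective (@loop_class S n w A).
Proof.
move=> p q; rewrite !loop_classE => /hclass_eq[].
- by apply: bar0_cocycle; apply: delta0_poly_in0.
- by apply: bar0_cocycle; apply: delta0_poly_in0.
move=> b bN1 db; apply/eqP; rewrite -subr_eq0; apply/eqP/(@delta0_poly_inj _ _ _ w).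
by exists b; rewrite // db linearB subr0.
Qed.

Lemma loop_class_surj h : exists p : {poly A}, @loop_class S n w A p = h.
Proof.
have [T /andP[T0 dT] ->] := hclass_surj h.
have [p Tp] := delta0_poly_surj T0; exists p; rewrite loop_classE.
by symmetry; apply/hclass_eq => //; apply: bar0_cocycle; rewrite // delta0_poly_in0.
Qed.

Definition loop_class_inv (h : Hbar C 0) : {poly A} := sval (cid (loop_class_surj h)).

Lemma loop_class_invK : cancel loop_class_inv (@loop_class S n w A).
Proof. by move=> h; rewrite /loop_class_inv; case: cid. Qed.

Lemma loop_classK : cancel (@loop_class S n w A) loop_class_inv.
Proof. by move=> p; apply: loop_class_inj; rewrite loop_class_invK. Qed.

Lemma loop_class_inv_linear : linear loop_class_inv.
Proof.
by move=> b h k; apply: loop_class_inj; rewrite loop_class_linear !loop_class_invK.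
Qed.
HB.instance Definition _ := GRing.isLinear.Build A (Hbar C 0) {poly A} *:%R loop_class_inv
  loop_class_inv_linear.
End Procedure.

Theorem proposition3p19 (A : idomainType) (hA : principal_ideal_domain A)
    (S : Type) (n : nat) (w : 'I_n -> S + S) :
  exists L : {linear Hbar (cochains A (loop w)) 0 -> {poly A}},
  (* L is the inverse of A[t] -> H^0_Bar *)
  (cancel (@loop_class S n w A) L /\ cancel L (@loop_class S n w A)) /\
  (* Bar^0 = T(C^1); its elements are cohomologous to polynomials in delta_0 *)
  (bar_in 0 =i submod_span (fun T : bar (cochains A (loop w)) => exists s, T = tens1 s)) /\
  (forall T : bar (cochains A (loop w)), T \in bar_in 0 ->
     exists p : {poly A}, cohomologous 0 T (delta0_poly w p)) /\
  (forall p : {poly A}, L (hclass 0 (delta0_poly w p)) = p) /\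
  (* (1) *)
  (forall s : seq (entry A n), modified_weight s = 0%N -> s = nseq (size s) EntT) /\
  (* (2) *)
  (forall (e1 : seq (entry A n)) (f : {ffun 'I_n -> A}) (e2 : seq (entry A n)),
     let s1 := map (entry_form w) e1 in
     let s2 := map (entry_form w) e2 in
     cohomologous 0 (tens1 (s1 ++ fdx w f :: s2))
       (int_word f *: tens1 (s1 ++ delta0 w A :: s2)
        - cup_left s1 (cobound w f) s2 + cup_right s1 (cobound w f) s2)) /\
  (forall f : {ffun 'I_n -> A},
     coch_mul (delta0 w A) (cobound w f) = - int_word f *: delta0 w A) /\
  (forall f : {ffun 'I_n -> A}, coch_mul (cobound w f) (delta0 w A) = 0) /\
  (forall f g : {ffun 'I_n -> A},
     coch_mul (fdx w g) (cobound w f)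
     = fdx w [ffun k => - int_from_tgt w f k * g k]) /\
  (forall f g : {ffun 'I_n -> A},
     coch_mul (cobound w f) (fdx w g)
     = fdx w [ffun k => - int_from_src w f k * g k]) /\
  (* the symbolic summands represent the expression in (2) *)
  (forall (e1 : seq (entry A n)) (f : {ffun 'I_n -> A}) (e2 : seq (entry A n)),
     let s1 := map (entry_form w) e1 in
     let s2 := map (entry_form w) e2 in
     bar_of w (expansion w e1 f e2)
     = int_word f *: tens1 (s1 ++ delta0 w A :: s2)
       - cup_left s1 (cobound w f) s2 + cup_right s1 (cobound w f) s2) /\
  (* (3) *)
  (forall (e1 : seq (entry A n)) (f : {ffun 'I_n -> A}) (e2 : seq (entry A n)) c,
     c \in summands w e1 f e2 ->
     (modified_weight c.2 < modified_weight (e1 ++ EntDx f :: e2))%N) /\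
  (* the procedure applies to every T, terminates, and computes L *)
  (forall T : bar (cochains A (loop w)), T \in bar_in 0 ->
     exists x : {malg A[seq (entry A n)]}, T = bar_of w x) /\
  well_founded (fun y x : {malg A[seq (entry A n)]} => reduces w x y) /\
  (forall x : {malg A[seq (entry A n)]}, ~ halted x -> exists y, reduces w x y) /\
  (forall x y : {malg A[seq (entry A n)]},
     clos_refl_trans _ (reduces w) x y -> halted y ->
     cohomologous 0 (bar_of w x) (delta0_poly w (result y)) /\
     L (hclass 0 (bar_of w x)) = result y).
Proof.
exists (loop_class_inv (w := w)); split.
  by split; [apply: loop_classK | apply: loop_class_invK].
have L_delta0 p : loop_class_inv (hclass 0 (delta0_poly w p)) = p.
  by rewrite -loop_classE loop_classK.
split; first exact: bar_in0E.
split; first exact: delta0_poly_surj.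
split; first exact: L_delta0.
split; first exact: modified_weight0.
split; first by move=> e1 f e2; apply: reduction_step_cohomologous.
split; first exact: delta0_cobound.
split; first exact: cobound_delta0.
split; first exact: fdx_cobound.
split; first exact: cobound_fdx.
split; first exact: bar_of_expansion.
split; first exact: summands_weight.
split; first exact: bar_of_surj.
split; first exact: reduces_wf.
split; first exact: reduces_progress.
move=> x y xy hy.
have xp : cohomologous 0 (bar_of w x) (delta0_poly w (result y)).
  by rewrite -bar_of_halted //; apply: reduction_cohomologous.
split; first exact: xp.
have xc : bar_of w x \in cocycle 0 := bar0_cocycle (bar_of_in0 w x).
have pc := bar0_cocycle (delta0_poly_in0 w (result y)).
rewrite -[LHS]/(loop_class_inv (hclass 0 (bar_of w x))).
by rewrite ((hclass_eq xc pc).2 xp) L_delta0.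
Qed.
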